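(* For $n\geqslant 2$ let $J_n:=J_{\mathbf 1_n}$ be the Forcey-Loday realization of weight $\mathbf 1_n=(1,\dots,1)$, and orient all polytopes as specified in the context. The Forcey-Loday realizations determine the sign conventions (B) for $A_\infty$-morphisms, namely: as oriented polytopes, $$\partial J_n=\bigcup_{\substack{i_1+i_2+i_3=n\\ i_2\geqslant 2}}(-1)^{i_1+i_2i_3}\,J_{i_1+1+i_3}\times K_{i_2}\ \cup\ -\bigcup_{\substack{i_1+\cdots+i_s=n\\ s\geqslant 2}}(-1)^{\epsilon_B}\,K_s\times J_{i_1}\times\cdots\times J_{i_s},\qquad \epsilon_B=\sum_{u=1}^s(s-u)(1-i_u),$$ where the facets are the intersections of $J_n$ with the hyperplanes bounding $D_{i_1,i_2,i_3}$ and $D^{i_1,\dots,i_s}$, identified through the maps $\theta$ of the context with the products $J_{\overline\omega}\times K_{\widetilde\omega}$ and $K_{\overline\omega}\times J_{\widetilde\omega_1}\times\cdots\times J_{\widetilde\omega_s}$ respectively, and the signs compare product orientations with the boundary orientation. Thus these signs are the coefficients of $f_{i_1+1+i_3}(\mathrm{id}^{\otimes i_1}\otimes m_{i_2}\otimes\mathrm{id}^{\otimes i_3})$ and $m_s(f_{i_1}\otimes\cdots\otimes f_{i_s})$ in the equation (B) $$[m_1,f_n]=\sum_{\substack{i_1+i_2+i_3=n\\ i_2\geqslant 2}}(-1)^{i_1+i_2i_3}f_{i_1+1+i_3}(\mathrm{id}^{\otimes i_1}\otimes m_{i_2}\otimes\mathrm{id}^{\otimes i_3})-\sum_{\substack{i_1+\cdots+i_s=n\\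 s\geqslant 2}}(-1)^{\epsilon_B}m_s(f_{i_1}\otimes\cdots\otimes f_{i_s}).$$
   Context: A weight is a list $\omega=(\omega_1,\dots,\omega_n)$ of positive real numbers. The Loday realization $K_\omega\subset\mathbb R^{n-1}$ is the intersection of $H_\omega:\ \sum_{i=1}^{n-1}x_i=\sum_{1\leqslant k<l\leqslant n}\omega_k\omega_l$ with the half-spaces $D_{i_1,i_2,i_3}:\ x_{i_1+1}+\cdots+x_{i_1+i_2-1}\geqslant\sum_{i_1+1\leqslant k<l\leqslant i_1+i_2}\omega_k\omega_l$ for all $i_1+i_2+i_3=n$, $i_1,i_3\geqslant0$, $2\leqslant i_2\leqslant n-1$. It has dimension $n-2$, realizes the associahedron $K_n$, and is oriented by the basis $e_j=(1,0,\dots,0,-1,0,\dots,0)$, $1\leqslant j\leqslant n-2$ ($-1$ in position $j+1$). The Forcey-Loday realization $J_\omega\subset\mathbb R^{n-1}$ is the intersection of the half-spaces $D_{i_1,i_2,i_3}$ (same inequality) for all $i_1+i_2+i_3=n$, $i_1,i_3\geqslant 0$, $i_2\geqslant2$, with the half-spaces $$D^{i_1,\dots,i_s}:\ x_{i_1}+x_{i_1+i_2}+\cdots+x_{i_1+\cdots+i_{s-1}}\leqslant 2\sum_{1\leqslant t<u\leqslant s}\Omega_t\Omega_u,\qquad \Omega_t:=\sum_{a=1}^{i_t}\omega_{i_1+\cdots+i_{t-1}+a},$$ for all $i_1+\cdots+i_s=n$, $i_t\geqslant1$, $s\geqslant2$. It has dimension $n-1$, realizes the multiplihedron $J_n$,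 and is oriented by the basis $f_j=(0,\dots,0,-1,0,\dots,0)$, $1\leqslant j\leqslant n-1$ ($-1$ in position $j$). Points are oriented positively. Facet identifications. For $(i_1,i_2,i_3)$: $\overline\omega=(\omega_1,\dots,\omega_{i_1},\omega_{i_1+1}+\cdots+\omega_{i_1+i_2},\omega_{i_1+i_2+1},\dots,\omega_n)$, $\widetilde\omega=(\omega_{i_1+1},\dots,\omega_{i_1+i_2})$ and $\theta\big((x_1,\dots,x_{i_1+i_3}),(y_1,\dots,y_{i_2-1})\big)=(x_1,\dots,x_{i_1},y_1,\dots,y_{i_2-1},x_{i_1+1},\dots,x_{i_1+i_3})$. For $(i_1,\dots,i_s)$: $\overline\omega=(\sqrt2\,\Omega_1,\dots,\sqrt2\,\Omega_s)$, $\widetilde\omega_t=(\omega_{i_1+\cdots+i_{t-1}+1},\dots,\omega_{i_1+\cdots+i_t})$ and $\theta:\mathbb R^{s-1}\times\mathbb R^{i_1-1}\times\cdots\times\mathbb R^{i_s-1}\to\mathbb R^{n-1}$ sends $(x_1,\dots,x_{s-1})\times(y^1_1,\dots,y^1_{i_1-1})\times\cdots\times(y^s_1,\dots,y^s_{i_s-1})$ to $(y^1_1,\dots,y^1_{i_1-1},x_1,y^2_1,\dots,y^2_{i_2-1},x_2,\dots,x_{s-1},y^s_1,\dots,y^s_{i_s-1})$. Boundary orientation: a basis of the tangent space to the boundary is positive iff preceding it by an outward-pointing vector gives a positive basis of the ambient oriented space. *)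

(* Defs.v *)
From HB Require Import structures.
From mathcomp Require Import all_boot all_order all_algebra.
From mathcomp Require Import all_classical all_reals all_analysis.
From mathcomp Require Import freeg.

Set Implicit Arguments.
Unset Strict Implicit.
Unset Printing Implicit Defensive.

Import Order.TTheory GRing.Theory Num.Theory.
Import numFieldNormedType.Exports.

Local Open Scope classical_set_scope.
Local Open Scope ring_scope.

(* A composition (i_1, ..., i_s) of n into positive parts; s = size i. *)
Definition composition (n : nat) (i : seq nat) : bool :=
  (sumn i == n) && all (leq 1) i.

(* epsilon_B(i_1, ..., i_s) = sum_(1 <= u <= s) (s - u)(1 - i_u). *)
Definition epsB (i : seq nat) : int :=
  \sum_(1 <= u < (size i).+1)
     ((size i)%:Z - u%:Z) * (1 - (nth 0%N i u.-1)%:Z).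

Section Lists.
Variable R : realType.

(* Entries of lists are numbered from 1, as in (x_1, ..., x_d). *)
Definition ent (s : seq R) (k : nat) : R := nth 0 s k.-1.

Definition coords d (x : 'rV[R]_d) : seq R := [seq x 0 j | j : 'I_d].

(* [tup n s] and [vec d s] retype a list whose length is, by an equation
   that need not hold by conversion, n or d; on such a list nothing is
   truncated or padded. *)
Definition tup n (s : seq R) : n.-tuple R := [tuple nth 0 s j | j < n].
Definition vec d (s : seq R) : 'rV[R]_d := \row_(j < d) nth 0 s j.

End Lists.

Section Polytopes.
Variable R : realType.

Definition unit_weight (n : nat) : n.-tuple R := [tuple 1 | _ < n].

(* D_(i1,i2,i3) is the half-space seg_sum >= seg_bound; i3 is determined by
   i1 and i2. *)
Definition seg_sum d (i1 i2 : nat) (x : 'rV[R]_d) : R :=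
  \sum_(i1 + 1 <= k < i1 + i2) ent (coords x) k.

Definition seg_bound (w : seq R) (i1 i2 : nat) : R :=
  \sum_(i1 + 1 <= k < (i1 + i2).+1) \sum_(k + 1 <= l < (i1 + i2).+1)
     ent w k * ent w l.

(* Omega_t, for 1 <= t <= s. *)
Definition Omega (w : seq R) (i : seq nat) (t : nat) : R :=
  \sum_(1 <= a < (nth 0%N i t.-1).+1) ent w (sumn (take t.-1 i) + a).

(* D^(i_1,...,i_s) is the half-space cut_sum <= cut_bound. *)
Definition cut_sum d (i : seq nat) (x : 'rV[R]_d) : R :=
  \sum_(1 <= t < size i) ent (coords x) (sumn (take t i)).

Definition cut_bound (w : seq R) (i : seq nat) : R :=
  2 * \sum_(1 <= t < (size i).+1) \sum_(t + 1 <= u < (size i).+1)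
        Omega w i t * Omega w i u.

(* Loday realization K_w; the hyperplane H_w is the case i1 = i3 = 0 of
   seg_sum = seg_bound. *)
Definition loday n (w : n.-tuple R) : set 'rV[R]_n.-1 :=
  [set x | seg_sum 0 n x = seg_bound w 0 n /\
     forall i1 i2 i3 : nat, (i1 + i2 + i3 = n)%N -> (2 <= i2 <= n - 1)%N ->
       seg_bound w i1 i2 <= seg_sum i1 i2 x].

(* Forcey-Loday realization J_w. *)
Definition forcey_loday n (w : n.-tuple R) : set 'rV[R]_n.-1 :=
  [set x |
    (forall i1 i2 i3 : nat, (i1 + i2 + i3 = n)%N -> (2 <= i2)%N ->
       seg_bound w i1 i2 <= seg_sum i1 i2 x) /\
    (forall s (i : s.-tuple nat), (2 <= s)%N -> composition n i ->
       cut_sum i x <= cut_bound w i)].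

Definition seg_facet n (w : n.-tuple R) (i1 i2 : nat) : set 'rV[R]_n.-1 :=
  forcey_loday w `&` [set x | seg_sum i1 i2 x = seg_bound w i1 i2].

Definition cut_facet n (w : n.-tuple R) (i : seq nat) : set 'rV[R]_n.-1 :=
  forcey_loday w `&` [set x | cut_sum i x = cut_bound w i].

(* The basis e_j (1 <= j <= d - 1) of the direction of a Loday realization in
   R^d, and the basis f_j (1 <= j <= d) of R^d. *)
Definition loday_basis d : seq 'rV[R]_d :=
  [seq \row_(k < d) ((k == 0 :> nat)%:R - (k == j :> nat)%:R)
     | j <- iota 1 d.-1].

Definition forcey_loday_basis d : seq 'rV[R]_d :=
  [seq - delta_mx 0 j | j : 'I_d].

End Polytopes.

Arguments unit_weight : clear implicits.
Arguments loday_basis : clear implicits.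
Arguments forcey_loday_basis : clear implicits.

Section FacetIdentifications.
Variable R : realType.

Definition seg_outer n (w : n.-tuple R) (i1 i2 i3 : nat) :
    (i1 + 1 + i3).-tuple R :=
  tup _ (take i1 w ++ \sum_(1 <= a < i2.+1) ent w (i1 + a)
                   :: drop (i1 + i2) w).

Definition seg_inner n (w : n.-tuple R) (i1 i2 : nat) : i2.-tuple R :=
  tup _ (take i2 (drop i1 w)).

Definition seg_theta n (i1 i2 i3 : nat)
    (p : 'rV[R]_(i1 + 1 + i3).-1 * 'rV[R]_i2.-1) : 'rV[R]_n.-1 :=
  vec _ (take i1 (coords p.1) ++ coords p.2 ++ drop i1 (coords p.1)).

Definition cut_outer n (w : n.-tuple R) s (i : s.-tuple nat) : s.-tuple R :=
  [tuple Num.sqrt 2 * Omega w i t.+1 | t < s].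

Definition cut_inner n (w : n.-tuple R) s (i : s.-tuple nat) (t : 'I_s) :
    (tnth i t).-tuple R :=
  tup _ (take (tnth i t) (drop (sumn (take t i)) w)).

(* y^1, x_1, y^2, x_2, ..., x_(s-1), y^s : the block y^(t+1) is preceded by
   x_t unless t = 0. *)
Definition cut_theta n s (i : s.-tuple nat)
    (p : 'rV[R]_s.-1 * (forall t : 'I_s, 'rV[R]_(tnth i t).-1)) :
    'rV[R]_n.-1 :=
  vec _ (flatten [seq (if t == 0 :> nat then [::] else [:: ent (coords p.1) t])
                        ++ coords (p.2 t) | t : 'I_s]).

(* J_(outer) x K_(inner) and its product orientation, carried to R^(n-1)
   by theta (which is linear). *)
Definition seg_product n (w : n.-tuple R) (i1 i2 i3 : nat) :
    set ('rV[R]_(i1 + 1 + i3).-1 * 'rV[R]_i2.-1) :=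
  forcey_loday (seg_outer w i1 i2 i3) `*` loday (seg_inner w i1 i2).

Definition seg_basis n (i1 i2 i3 : nat) : seq 'rV[R]_n.-1 :=
  [seq @seg_theta n i1 i2 i3 (v, 0) | v <- forcey_loday_basis R (i1 + 1 + i3).-1] ++
  [seq @seg_theta n i1 i2 i3 (0, v) | v <- loday_basis R i2.-1].

(* K_(outer) x J_(inner_1) x ... x J_(inner_s) and its product orientation. *)
Definition cut_product n (w : n.-tuple R) s (i : s.-tuple nat) :
    set ('rV[R]_s.-1 * (forall t : 'I_s, 'rV[R]_(tnth i t).-1)) :=
  [set p | loday (cut_outer w i) p.1 /\
           forall t : 'I_s, forcey_loday (cut_inner w i t) (p.2 t)].

Definition cut_basis n s (i : s.-tuple nat) : seq 'rV[R]_n.-1 :=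
  let y0 : forall t : 'I_s, 'rV[R]_(tnth i t).-1 := fun=> 0 in
  [seq @cut_theta n s i (v, y0) | v <- loday_basis R s.-1] ++
  flatten [seq [seq @cut_theta n s i (0, dfwith y0 t v)
                  | v <- forcey_loday_basis R (tnth i t).-1] | t : 'I_s].

End FacetIdentifications.

Arguments seg_theta {R} n i1 i2 i3 p.
Arguments cut_theta {R} n {s} i p.
Arguments seg_product {R n} w i1 i2 i3 _.
Arguments cut_product {R n} w {s} i _.
Arguments seg_basis : clear implicits.
Arguments cut_basis R n {s} i.

Section Orientations.
Variables (R : realType) (d : nat).
Implicit Types (P F : set 'rV[R]_d) (b : seq 'rV[R]_d).

Definition frontier P : set 'rV[R]_d := closure P `\` P^°.

(* b is a basis of the tangent space of P, that is, of the vector space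
   spanned by the differences of points of P. *)
Definition tangent_basis P b : Prop :=
  [/\ P !=set0, free b &
      forall U : {vspace 'rV[R]_d},
        (forall p q, P p -> P q -> p - q \in U) <-> (span b <= U)%VS].

(* The sign of the change of basis between two ordered bases of R^d. *)
Definition orientation_sign b b' : int :=
  let M c : 'M[R]_d := \matrix_(a < d) nth 0 c a in
  sgz (\det (M b *m invmx (M b'))).

(* v is outward-pointing at the boundary point p of P: moving along -v enters
   the interior of P, moving along v leaves P. In particular v is transverse
   to every facet of P through p. *)
Definition outward_pointing P (p v : 'rV[R]_d) : Prop :=
  exists2 e : R, 0 < e &
    forall t : R, 0 < t < e -> P^° (p - t *: v) /\ ~ P (p + t *: v).

(* F, oriented by b, is eps = +1 or -1 times the facet F of P with its
   boundary orientation, where P is full-dimensional and oriented by bP. *)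
Definition boundary_orientation P bP F b (eps : int) : Prop :=
  [/\ tangent_basis F b,
      (exists p v, F p /\ outward_pointing P p v) &
      forall p v, F p -> outward_pointing P p v ->
        orientation_sign (v :: b) bP = eps].

End Orientations.

(* The operations of an A_infinity-morphism and their formal composites:
   [Id] is the identity, [Mop k] is m_k, [Fop k] is f_k, and (g, [:: h1; ...;
   hk]) stands for g(h1 (x) ... (x) hk). *)
Inductive operation := Id | Mop of nat | Fop of nat.

Definition operation_encode (o : operation) : option (nat + nat) :=
  match o with Id => None | Mop k => Some (inl k) | Fop k => Some (inr k) end.
Definition operation_decode (o : option (nat + nat)) : operation :=
  match o with
  | None => Id | Some (inl k) => Mop k | Some (inr k) => Fop k
  end.
Lemma operation_encodeK : cancel operation_encode operation_decode.
Proof. by case. Qed.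
HB.instance Definition _ := Choice.copy operation (can_type operation_encodeK).

Definition composite : choiceType := (operation * seq operation)%type.

(* f_(i1+1+i3)(id^(x i1) (x) m_i2 (x) id^(x i3)) *)
Definition f_after_m (i1 i2 i3 : nat) : composite :=
  (Fop (i1 + 1 + i3), nseq i1 Id ++ Mop i2 :: nseq i3 Id).

(* m_s(f_(i_1) (x) ... (x) f_(i_s)) *)
Definition m_after_f (i : seq nat) : composite :=
  (Mop (size i), [seq Fop k | k <- i]).

(* The right-hand side of equation (B), the expression of [m_1, f_n] as an
   integral linear combination of formal composites. *)
Definition equationB (n : nat) : {freeg composite} :=
  \sum_(i1 < n.+1) \sum_(i2 < n.+1) \sum_(i3 < n.+1 |
       (i1 + i2 + i3 == n)%N && (2 <= i2)%N)
     (-1 : int) ^+ (i1 + i2 * i3) *: << f_after_m i1 i2 i3 >>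
  - \sum_(s < n.+1 | (2 <= s)%N)
    \sum_(i : s.-tuple 'I_n.+1 | composition n (map val i))
     (-1 : int) ^ epsB (map val i) *: << m_after_f (map val i) >>.

(* Main.v *)
(** For a set [A] of coordinates let [h A] be the number of intervals contained
    in [A] and [g A] twice the number of intervals meeting [A]. Then [J_n] is the
    set of the [x] with [h A <= x(A) <= g A] for all [A], where [h] is
    supermodular, [g] is submodular and [g A - h B >= g (A \ B) - h (B \ A)].
    These inequalities imply that on a hyperplane [x(I) = h I] or [x(S) = g S]
    the remaining constraints split into those of the factors of the facet, whose
    bounds count the intervals according to their trace on the coordinates of the
    factor. Sharing a suitable constant evenly among the coordinates in a subset of
    each interval yields points at which exactly one prescribed constraint is tight, so that every
    facet has full dimension. Finally, if [b] is a basis of the facet, then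
    [v |-> det (v, b)] is a multiple of the linear form defining the facet; its
    sign can be computed at one outward vector, plus or minus a coordinate vector,
    where it is, up to sign, the signature of a shuffle of the coordinates. *)

From mathcomp Require Import all_boot all_order all_algebra all_fingroup.
From mathcomp Require Import zify ring lra.

Set Implicit Arguments.
Unset Strict Implicit.
Unset Printing Implicit Defensive.

Import Order.TTheory GRing.Theory Num.Theory.
Local Open Scope ring_scope.

(** * Determinants of lists of row vectors *)

(** The product of the weights [k < l] belongs to the interval of coordinates from [k] to [l - 1]:
    [seg_bound] collects the pairs whose interval lies in the segment, [cut_bound] twice the pairs
    whose interval contains a cut. The obstacle is that the factors of a facet of [J_n] no longer
    have unit weights. Their weights are lengths of blocks of unit weights, multiplied by
    [Num.sqrt 2] in the Loday factor of an upper facet. Expanding products of block lengths turns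
    the bounds of a factor back into counts of intervals, and [Num.sqrt 2] squares to the 2 of the
    upper bounds. For the orientations, [e_j = f_(j+1) - f_1]. Hence, once a multiple of the vector
    [f] at the first coordinate of the Loday factor stands in front, the product basis may be
    replaced by a list of vectors [f_k]. That vector points outwards with coefficient 1 for a lower
    bound and -1 for an upper bound; this is the origin of the minus sign before the second
    union. *)

Section RowsDet.
Variables (F : fieldType) (d : nat).
Implicit Types (l A B : seq 'rV[F]_d).

(** Short lists are padded with zero rows and long ones are truncated; the size conditions below
    ensure that the rows being moved are rows of the matrix. *)
Definition rows_mx l : 'M[F]_d := \matrix_(a < d) nth 0 l a.
Definition rows_det l : F := \det (rows_mx l).

Lemma rows_det_swap l1 u v l2 : ((size l1).+1 < d)%N ->
  rows_det (l1 ++ u :: v :: l2) = - rows_det (l1 ++ v :: u :: l2).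
Proof.
move=> lt_d; pose i := Ordinal (ltnW lt_d); pose j := Ordinal lt_d.
have neq_ij : i != j by rewrite -val_eqE /= neq_ltn ltnSn.
rewrite /rows_det; have -> : rows_mx (l1 ++ u :: v :: l2) =
    xrow i j (rows_mx (l1 ++ v :: u :: l2)).
  apply/matrixP => a c; rewrite !mxE !nth_cat.
  case: tpermP => [->|->|/eqP ia /eqP ja].
  - by rewrite ltnn subnn /= ltnNge leqnSn subSnn.
  - by rewrite ltnn subnn /= ltnNge leqnSn subSnn.
  move: ia ja; rewrite -!val_eqE /= => ia ja; case: ltnP => // le_a.
  by case def_k: (_ - _)%N => [|[|k]] //; exfalso; lia.
by rewrite xrowE det_mulmx det_perm odd_tperm neq_ij expr1 mulN1r.
Qed.

Lemma rows_det_move l1 u l2 l3 : (size l1 + size l2 < d)%N ->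
  rows_det (l1 ++ u :: l2 ++ l3) =
  (-1) ^+ size l2 * rows_det (l1 ++ l2 ++ u :: l3).
Proof.
elim: l2 l1 => [|v l2 IH] l1 /= lt_d; first by rewrite mul1r.
rewrite rows_det_swap; last first.
  by apply: leq_ltn_trans lt_d; rewrite addnS ltnS leq_addr.
rewrite -cat_rcons IH; last by rewrite size_rcons addSnnS.
by rewrite cat_rcons exprS mulN1r mulNr.
Qed.

Lemma rows_det_move_block l1 A B l3 : (size l1 + size A + size B <= d)%N ->
  rows_det (l1 ++ A ++ B ++ l3) =
  (-1) ^+ (size A * size B) * rows_det (l1 ++ B ++ A ++ l3).
Proof.
elim: A l1 l3 => [|u A IH] l1 l3 /= le_d; first by rewrite mul1r.
rewrite -cat_rcons IH; last by rewrite size_rcons addSnnS.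
rewrite cat_rcons rows_det_move; last first.
  by apply: leq_trans le_d; rewrite addnS addSn ltnS leq_add2r leq_addr.
by rewrite mulrA -exprD mulSn addnC.
Qed.

Lemma free_rows l : size l = d -> free l = (rows_det l != 0).
Proof.
move=> sz_l; rewrite /rows_det -unitfE -[_ \is a GRing.unit]/(_ \in unitmx).
rewrite -row_free_unit.
pose X : d.-tuple 'rV[F]_d := Tuple (introT eqP sz_l).
have -> : free l = free X by [].
have sumE (k : 'rV[F]_d) : k *m rows_mx l = \sum_(i < d) k 0 i *: X`_i.
  by rewrite mulmx_sum_row; apply: eq_bigr => i _; rewrite rowK.
apply/freeP/idP => [free_k | inj_l k sum0 i].
  apply: inj_row_free => k; rewrite sumE => /free_k k0.
  by apply/rowP => i; rewrite k0 mxE.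
have /row_free_inj inj0 := inj_l.
have: \row_j k j = 0 :> 'rV[F]_d.
  by apply: inj0; rewrite mul0mx sumE -[RHS]sum0; apply: eq_bigr => j _; rewrite mxE.
by move/rowP/(_ i); rewrite !mxE.
Qed.

End RowsDet.

(** Adding multiples of the leading row amounts to multiplying by the unipotent lower triangular
    matrix [E]. This clears the common term of the differences that make up a Loday basis. *)
Lemma rows_det_add (F : fieldType) d (v : 'rV[F]_d.+1) l l' (c : nat -> F) :
  (forall a, (a < d)%N -> nth 0 l' a = nth 0 l a + c a *: v) ->
  rows_det (v :: l') = rows_det (v :: l).
Proof.
move=> def_l'; pose E : 'M[F]_d.+1 := \matrix_(a, k)
  ((a == k)%:R + (if (k == 0) && (a != 0) then c a.-1 else 0)).
have -> : rows_det (v :: l') = \det (E *m rows_mx (v :: l)).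
  congr (\det _); apply/matrixP => a k; rewrite !mxE.
  under eq_bigr do rewrite !mxE mulrDl.
  rewrite big_split /= (bigD1 a) //= eqxx mul1r big1 ?addr0 => [|j /negPf ja]; last first.
    by rewrite eq_sym ja mul0r.
  rewrite (bigD1 0) //= big1 ?addr0 => [|j /negPf ->]; last by rewrite mul0r.
  case: (unliftP 0 a) => [b|] -> /=; last by rewrite mul0r addr0.
  by rewrite def_l' ?ltn_ord // !mxE.
rewrite det_mulmx det_trig.
  rewrite big1 ?mul1r // => i _; rewrite mxE eqxx.
  by case: (i == 0); rewrite //= addr0.
apply/is_trig_mxP => i j lt_ij; rewrite mxE.
have -> : (i == j) = false by apply/negbTE; rewrite -val_eqE neq_ltn lt_ij.
have -> : (j == 0) = false; last by rewrite addr0.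
by apply/negbTE; rewrite -val_eqE /= -lt0n (leq_ltn_trans _ lt_ij).
Qed.

Lemma rows_det_linear (F : fieldType) d (b : seq 'rV[F]_d.+1) c u v :
  rows_det (c *: u + v :: b) = c * rows_det (u :: b) + rows_det (v :: b).
Proof.
rewrite -[rows_det (v :: b)]mul1r; apply: (@determinant_multilinear _ _ _ _ _ 0).
- by rewrite !rowK scale1r.
- by apply/matrixP => i j; rewrite !mxE.
- by apply/matrixP => i j; rewrite !mxE.
Qed.

Lemma rows_detN (F : fieldType) d (u : 'rV[F]_d.+1) b :
  rows_det (- u :: b) = - rows_det (u :: b).
Proof.
have det0 : rows_det (0 :: b) = 0.
  have := rows_det_linear b 1 0 0; rewrite scaler0 addr0 mul1r => /eqP.
  by rewrite addrC -subr_eq subrr => /eqP.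
by have := rows_det_linear b (-1) u 0; rewrite scaleN1r addr0 det0 addr0 mulN1r.
Qed.

(** * Signs of shuffles of coordinate vectors *)

Section CoordinateRows.
Variables (F : fieldType) (d : nat).

(** The vector [f_(k+1)] of the ambient orientation, indexed by a natural number so that bases
    become lists of positions. *)
Definition fvec (k : nat) : 'rV[F]_d := \row_(j < d) - (k == j)%:R.

Lemma rows_det_fvec : rows_det [seq fvec k | k <- iota 0 d] = (-1) ^+ d.
Proof.
rewrite /rows_det; have -> : rows_mx [seq fvec k | k <- iota 0 d] = (-1)%:M.
  apply/matrixP => a b; rewrite !mxE (nth_map 0) ?size_iota // nth_iota //.
  by rewrite mxE add0n -val_eqE /=; case: eqP; rewrite ?oppr0 ?mulr0n.
by rewrite det_scalar.
Qed.

Fixpoint cut_positions o (i : seq nat) : seq nat :=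
  if i is j :: i' then
    if i' is _ :: _ then (o + j).-1%N :: cut_positions (o + j)%N i' else [::]
  else [::].

Fixpoint block_positions o (i : seq nat) : seq nat :=
  if i is j :: i' then iota o j.-1 ++ block_positions (o + j)%N i' else [::].

(* The number of adjacent transpositions that sort the cut positions followed by
   the blocks. *)
Fixpoint unshuffle (i : seq nat) : nat :=
  if i is j :: i' then (size i' * j.-1 + unshuffle i')%N else 0%N.

Lemma size_cut_positions o i : size (cut_positions o i) = (size i).-1.
Proof. by elim: i o => [|j [|k i] IH] o //=; rewrite IH. Qed.

(** Induction on the parts behind a sorted prefix of length [o]: the first block crosses all the
    cuts, one for each later part, and the first cut then follows it to complete a longer sorted
    prefix. *)
Lemma rows_det_unshuffle o i : (o + sumn i = d.+1)%N -> all (leq 1) i ->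
    i != [::] ->
  rows_det [seq fvec k | k <- iota 0 o ++ cut_positions o i ++ block_positions o i]
  = (-1) ^+ unshuffle i * (-1) ^+ d.
Proof.
elim: i o => [//|j i IH] o /= sum_i /andP[j_gt0 i_gt0] _.
have o_iota : iota 0 o ++ iota o j.-1 = iota 0 (o + j).-1.
  by rewrite -{2}[o]add0n -iotaD; congr iota; lia.
have [i0|i_neq0] := eqVneq i [::].
  rewrite {}i0 in sum_i *; rewrite /= cats0 o_iota mul0n mul1r -rows_det_fvec.
  by congr (rows_det (map _ (iota _ _))); move: sum_i => /=; lia.
have size_sum (l : seq nat) : all (leq 1) l -> (size l <= sumn l)%N.
  by elim: l => //= a l le_l /andP[? /le_l]; lia.
have size_i : (0 < size i)%N by rewrite lt0n size_eq0.
have -> : (if i is _ :: _ then (o + j).-1 :: cut_positions (o + j) i else [::])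
    = (o + j).-1 :: cut_positions (o + j) i by case: (i) i_neq0.
rewrite !map_cat rows_det_move_block; last first.
  rewrite !size_map !size_iota /= size_cut_positions.
  by have := size_sum _ i_gt0; lia.
rewrite -!map_cat /= catA o_iota !size_map size_iota /= size_cut_positions.
rewrite prednK // -cat_rcons -cats1.
have -> : iota 0 (o + j).-1 ++ [:: (o + j).-1] = iota 0 (o + j).
  by rewrite -{2}[(o + j).-1]add0n -[[:: _]]/(iota _ 1) -iotaD addn1 prednK //; lia.
by rewrite IH ?addnA // -?addnA // mulrA -exprD.
Qed.

End CoordinateRows.

(** The leading [i1] crosses [i1] rows and the last two blocks are exchanged; the resulting exponent
    [i1 + i3 * (i2 - 2)] has the parity of [i1 + i2 * i3]. *)
Lemma rows_det_seg (F : fieldType) d i1 i2 i3 :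
    (i1 + i2 + i3 = d.+1)%N -> (2 <= i2)%N ->
  rows_det [seq fvec F d k
    | k <- i1 :: iota 0 i1 ++ iota (i1 + i2.-1) i3 ++ iota i1.+1 i2.-2]
  = (-1) ^+ (i1 + i2 * i3) * (-1) ^+ d.
Proof.
move=> sum_i i2_ge2; rewrite map_cons !map_cat -[_ :: _]cat0s rows_det_move; last first.
  by rewrite !size_map !size_iota /=; lia.
rewrite cat0s !size_map !size_iota -cat_rcons -map_rcons.
rewrite -[X in _ ++ X ++ _]cats0 -!catA [_ ++ [::] ++ _]/= -(cats0 (map _ (iota i1.+1
  _))).
rewrite rows_det_move_block; last first.
  by rewrite !size_map size_rcons !size_iota; lia.
rewrite !size_map !size_iota cats0 -!map_cat mulrA -exprD.
have -> : rcons (iota 0 i1) i1 ++ iota i1.+1 i2.-2 ++ iota (i1 + i2.-1) i3 = iota 0 d.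
  rewrite -cats1 -[[:: _]]/(iota _ 1) -{2}[i1]add0n -iotaD addn1.
  rewrite -{2}[i1.+1]add0n catA -iotaD.
  have -> : (i1 + i2.-1 = 0 + (i1.+1 + i2.-2))%N by lia.
  by rewrite -iotaD; congr iota; lia.
rewrite rows_det_fvec; congr (_ * _).
have -> : (i1 + i2 * i3 = i1 + i3 * i2.-2 + i3.*2)%N by nia.
by rewrite [in RHS]exprD -mul2n exprM sqrrN expr1n expr1n mulr1.
Qed.

(** * Lower and upper bounds attached to a system of finite sets *)

Lemma subset_at (V : finType) (A B : {set V}) :
  A \subset B -> forall p, (p \in A) ==> (p \in B).
Proof. by move=> /subsetP sAB p; apply/implyP/sAB. Qed.

Lemma set0_at (V : finType) (A : {set V}) : A == set0 -> forall p, p \notin A.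
Proof. by move=> /eqP-> p; rewrite inE. Qed.

(* Decides entailments between inclusions and (non)emptiness of Boolean
   combinations of sets, by instantiating them at the elements witnessing the
   failed inclusions and the nonemptiness hypotheses. *)
Ltac set_split :=
  repeat match goal with
  | |- context [subset ?A ?B] =>
      let H := fresh "H" in case: (boolP (subset A B)) => H
  | |- context [?A == set0] =>
      let H := fresh "H" in
      case: (boolP (A == set0)) => H
  end.
Ltac set_witness :=
  repeat match goal with
  | H : is_true (~~ (subset _ _)) |- _ =>
      let p := fresh "p" in case/subsetPn: H => p; rewrite ?inE => ? ?
  | H : is_true (_ != set0) |- _ =>
      let p := fresh "p" in case/set0Pn: H => p; rewrite ?inE => ?
  end.
Ltac set_close :=
  exfalso; set_witness;
  repeat match goal with
  | H : is_true (subset _ _) |- _ => move/subset_at: H => H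
  | H : is_true (_ == set0) |- _ => move/set0_at: H => H
  end;
  match goal with p : _, _ : is_true _ |- _ =>
    repeat match goal with
    | H : forall _, is_true (_ ==> _) |- _ => move: (H p); clear H
    | H : forall _, is_true (_ \notin _) |- _ => move: (H p); clear H
    end;
    repeat match goal with H : is_true _ |- _ => move: H end;
    rewrite ?inE;
    repeat match goal with |- context [p \in ?A] => case: (p \in A) => //= end; by []
  end.
Ltac set_tauto := rewrite ?subsetT ?setIT /=; set_split; rewrite /= ?addn0; try by [];
  try set_close.

Section SetSystem.
Variables (V I : finType) (T : I -> {set V}).
Implicit Types A B D M S : {set V}.

(* A factor of a facet keeps the coordinates [M] inside a range [D]; its pairs
   of weights correspond to the sets of the family that lie in [D] and meet [M]. *)
Definition count_sets (Q : pred {set V}) : nat := \sum_i Q (T i).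

Definition low D M A : nat := count_sets
  (fun t => [&& t \subset D, t :&: M != set0 & t :&: M \subset A]).

Definition up D A : nat := count_sets
  (fun t => (t \subset D) && (t :&: A != set0)).

Variables (R : realFieldType) (x : V -> R).

Definition xsum A : R := \sum_(p in A) x p.

Lemma xsum_setID A B : xsum A = xsum (A :&: B) + xsum (A :\: B).
Proof. exact: big_setID. Qed.

Definition J_bounds D M := forall A, A \subset M ->
  (low D M A)%:R <= xsum A <= 2 * (up D A)%:R.

(** The constant is 1 for the Loday factor of a lower facet, and 2, the square of [Num.sqrt 2], for
    that of an upper facet. *)
Definition K_bounds (c : R) D M := xsum M = c * (low D M M)%:R /\
  forall A, A \subset M -> c * (low D M A)%:R <= xsum A.

Lemma xsumUC J A : A \subset ~: J -> xsum (A :|: J) = xsum A + xsum J.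
Proof.
move=> sAC; rewrite (xsum_setID _ J) setIC setKU addrC; congr (_ + _).
congr xsum; apply/setP => p; rewrite !inE.
by move: (subset_at sAC p); rewrite !inE; do 2!case: (p \in _).
Qed.

(** Lower bounds outside [J] come from [x(A) = x(A :|: J) - x(J)]. Conversely, since [x(J)] is
    known, the lower bound on [J :\: A] bounds [x(A :&: J)] from above. The counting inequalities
    are checked separately for each set of the family. *)
Lemma seg_facet_bounds J :
  J_bounds setT setT /\ xsum J = (low setT setT J)%:R <->
  J_bounds setT (~: J) /\ K_bounds 1 J J.
Proof.
have lowJ : low J J J = low setT setT J.
  by apply: eq_bigr => i _ /=; congr nat_of_bool; set t := T i; set_tauto.
split=> [[bnd eqJ] | [bndC [eqJ bndJ]]].
  split; last split; last 1 first.
  - move=> A sAJ; rewrite mul1r; have /andP[le_A _] := bnd A (subsetT A).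
    apply: le_trans le_A; rewrite ler_nat; apply: leq_sum => i _ /=.
    by set t := T i; set_tauto.
  - move=> A sAC; have /andP[le_AJ _] := bnd (A :|: J) (subsetT _).
    have /andP[_ ->] := bnd A (subsetT _); rewrite andbT.
    move: le_AJ; rewrite xsumUC // eqJ.
    suff: (low setT (~: J) A + low setT setT J <= low setT setT (A :|: J))%N.
      by rewrite -(ler_nat R) natrD; lra.
    rewrite -big_split /=; apply: leq_sum => i _ /=.
    by set t := T i; set_tauto.
  by rewrite mul1r eqJ lowJ.
rewrite mul1r lowJ in eqJ; split=> // A _.
have sDC : A :\: J \subset ~: J by rewrite setDE subsetIr.
have bndC' := bndC _ sDC.
have bndJ' := bndJ (J :&: A) (subsetIl _ _).
have bndJ'' := bndJ (J :\: A) (subsetDl _ _).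
have eqJA := xsum_setID J A; have := xsum_setID A J; rewrite setIC => eqA.
have leL : (low setT setT A <= low setT (~: J) (A :\: J) + low J J (J :&: A))%N.
  by rewrite -big_split /=; apply: leq_sum => i _ /=; set t := T i; set_tauto.
have leU : (low setT setT J + 2 * up setT (A :\: J)
            <= 2 * up setT A + low J J (J :\: A))%N.
  rewrite !big_distrr -!big_split /=; apply: leq_sum => i _ /=.
  by set t := T i; set_tauto.
move: leL leU; rewrite -!(ler_nat R) !natrD; lra.
Qed.

Section CutFacet.
Variables (S : {set V}) (U : finType) (b : V -> U).
Let B u := [set p in ~: S | b p == u].
Hypothesis connected : forall i p q,
  T i :&: S == set0 -> p \in T i -> q \in T i -> b p = b q.

Lemma subset_block u : B u \subset ~: S.
Proof. by apply/subsetP => p; rewrite inE => /andP[]. Qed.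

Lemma sub_block i p : T i :&: S == set0 -> p \in T i -> T i \subset B (b p).
Proof.
move=> TS Tp; apply/subsetP => q Tq; rewrite !inE (connected TS Tq Tp) eqxx andbT.
by have := set0_at TS q; rewrite inE Tq.
Qed.

Lemma xsum_blocks A : xsum (A :\: S) = \sum_u xsum (A :&: B u).
Proof.
rewrite /xsum (partition_big b predT) //=; apply: eq_bigr => u _.
by apply: eq_bigl => p; rewrite !inE [_ && (p \in A)]andbC andbA.
Qed.

Lemma sum_pred1_nat u (F : U -> bool) :
  (forall v, v != u -> F v = false) -> (\sum_v F v = F u)%N.
Proof. by move=> F0; rewrite (bigD1 u) //= big1 ?addn0 // => v /F0->. Qed.

(** Upper bounds become lower bounds of the Loday factor by [x(A) = x(S) - x(S :\: A)], as
    [up S - up (S :\: A)] counts the sets that meet [S] with trace inside [A]. Upper bounds on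
    [A :|: S] give those of a block. Conversely the bounds of the blocks add up, because by
    [connected] a set of the family that misses [S] lies in a single block. *)
Lemma cut_facet_bounds :
  J_bounds setT setT /\ xsum S = 2 * (up setT S)%:R <->
  K_bounds 2 setT S /\ forall u, J_bounds (B u) (B u).
Proof.
have lowS : low setT S S = up setT S.
  by apply: eq_bigr => i _ /=; congr nat_of_bool; set t := T i; set_tauto.
split=> [[bnd eqS] | [[eqS bndS] bndB]].
  split=> [|u A sAB]; first split=> [|A sAS]; first by rewrite eqS lowS.
    have /andP[_ le_SA] := bnd (S :\: A) (subsetT _).
    have := xsum_setID S A; rewrite eqS (setIidPr sAS) => eqSA.
    have : (low setT S A + up setT (S :\: A) <= up setT S)%N.
      by rewrite -big_split /=; apply: leq_sum => i _ /=; set t := T i; set_tauto.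
    by rewrite -(ler_nat R) natrD; lra.
  have sBC := subset_block u; apply/andP; split.
    have /andP[le_A _] := bnd A (subsetT A).
    apply: le_trans le_A; rewrite ler_nat; apply: leq_sum => i _ /=.
    by move: (T i) (B u) => t Bu; set_tauto.
  have /andP[_] := bnd (A :|: S) (subsetT _).
  rewrite xsumUC ?(subset_trans sAB) // eqS.
  suff: (up setT (A :|: S) <= up (B u) A + up setT S)%N.
    by rewrite -(ler_nat R) natrD; lra.
  rewrite -big_split /=; apply: leq_sum => i _ /=.
  have [TS|TS] := boolP (T i :&: S == set0); last first.
    by set t := T i in TS *; set_tauto.
  have [A0|/set0Pn[p /setIP[Tp Ap]]] := boolP (T i :&: A == set0).
    by set t := T i in TS A0 *; set_tauto.
  have := sub_block TS Tp.
  have : p \in B u by rewrite (subsetP sAB).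
  rewrite inE => /andP[_ /eqP ->] => sTB.
  have A0 : T i :&: A != set0 by apply/set0Pn; exists p; rewrite inE Tp.
  by move: (T i) (B u) TS A0 sTB => t Bu TS A0 sTB; set_tauto.
rewrite lowS in eqS; split=> // A _.
have bS1 := bndS (A :&: S) (subsetIr _ _).
have bS2 := bndS (S :\: A) (subsetDl _ _).
have eqSA := xsum_setID S A; have eqA := xsum_setID A S.
rewrite xsum_blocks in eqA; rewrite setIC in eqSA.
have bB u := bndB u (A :&: B u) (subsetIr _ _).
have sum_lo : (\sum_u low (B u) (B u) (A :&: B u))%:R <= \sum_u xsum (A :&: B u).
  by rewrite natr_sum; apply: ler_sum => u _; case/andP: (bB u).
have sum_up : \sum_u xsum (A :&: B u) <= 2 * (\sum_u up (B u) (A :&: B u))%:R.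
  by rewrite natr_sum mulr_sumr; apply: ler_sum => u _; case/andP: (bB u).
have leL : (low setT setT A <= \sum_u low (B u) (B u) (A :&: B u)
                               + 2 * low setT S (A :&: S))%N.
  rewrite exchange_big /= big_distrr -big_split /=; apply: leq_sum => i _ /=.
  have [TS|TS] := boolP (T i :&: S == set0); last first.
    by apply: leq_trans (leq_addl _ _); set t := T i in TS *; set_tauto.
  have [T0|/set0Pn[p Tp]] := boolP (T i == set0).
    by rewrite (eqP T0) set0I eqxx andbF.
  rewrite (bigD1 (b p)) //= -!addnA; apply: leq_trans (leq_addr _ _).
  have := sub_block TS Tp; have : T i != set0 by apply/set0Pn; exists p.
  by move: (T i) (B _) => t Bu ? ?; set_tauto.
have leU : (\sum_u up (B u) (A :&: B u) + up setT S <= up setT A + low setT S (S :\: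
  A))%N.
  rewrite exchange_big /= -!big_split /=; apply: leq_sum => i _ /=.
  have [TS|TS] := boolP (T i :&: S == set0); last first.
    rewrite big1 => [|u _]; last first.
      apply/eqP; rewrite eqb0; move: (T i) (B u) TS (subset_block u) => t Bu TS sBC.
      by set_tauto.
    by rewrite subsetT; set t := T i in TS *; set_tauto.
  have [T0|/set0Pn[p Tp]] := boolP (T i == set0).
    by rewrite (eqP T0) big1 ?set0I ?eqxx ?andbF // => u _; rewrite set0I eqxx andbF.
  rewrite (sum_pred1_nat (u := b p)) => [|v].
    by move: (T i) (B _) TS Tp => t Bu TS Tp; set_tauto.
  apply: contra_neqF => /andP[/subsetP/(_ p Tp)]; rewrite inE => /andP[_ /eqP] //.
move: leL leU; rewrite -!(ler_nat R) !natrD; lra.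
Qed.

End CutFacet.

End SetSystem.

Lemma ltr_sum_exists (R : numDomainType) (I : finType) (a b : I -> R) :
  (forall i, a i <= b i) -> (exists i, a i < b i) -> \sum_i a i < \sum_i b i.
Proof.
move=> le_ab [i lt_ab]; rewrite (bigD1 i) //= [ltRHS](bigD1 i) //=.
by rewrite ltr_leD // ler_sum.
Qed.

(** * Points with prescribed tight bounds *)

Section Spread.
Variables (V I : finType) (T : I -> {set V}) (R : realFieldType).
Implicit Types A B : {set V}.

(** The part of a unit spread evenly over [B] that falls in [A]. It is 0 for empty [B], by the
    convention on division by 0, so empty sets of the family contribute nothing. *)
Definition share A B : R := #|A :&: B|%:R / #|B|%:R.

Lemma share_ge0 A B : 0 <= share A B.
Proof. by rewrite divr_ge0. Qed.

Lemma share_le1 A B : share A B <= 1.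
Proof.
have [->|B0] := eqVneq B set0; first by rewrite /share cards0 invr0 mulr0.
rewrite ler_pdivrMr ?ltr0n ?card_gt0 // mul1r ler_nat.
exact/subset_leq_card/subsetIr.
Qed.

Lemma share1 A B : B \subset A -> B != set0 -> share A B = 1.
Proof.
by move=> /setIidPr sBA B0; rewrite /share sBA divff // pnatr_eq0 cards_eq0.
Qed.

Lemma share0 A B : A :&: B = set0 -> share A B = 0.
Proof. by rewrite /share => ->; rewrite cards0 mul0r. Qed.

Lemma share_gt0 A B : A :&: B != set0 -> 0 < share A B.
Proof.
move=> AB; rewrite divr_gt0 ?ltr0n ?card_gt0 //.
by apply: contraNneq AB => ->; rewrite setI0.
Qed.

Lemma share_lt1 A B : ~~ (B \subset A) -> share A B < 1.
Proof.
move=> nsBA; have B0 : B != set0 by apply: contraNneq nsBA => ->; rewrite sub0set.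
rewrite ltr_pdivrMr ?ltr0n ?card_gt0 // mul1r ltr_nat proper_card //.
by rewrite properE subsetIr subsetI subxx andbT.
Qed.

Variables (mu : I -> R) (supp : I -> {set V}).

(** With [mu i] between 1 and 2, a set inside [A] gives at least 1 to [A], a set meeting [A] at most
    2, and a set missing [A] nothing; [low] and twice [up] are the sums of these termwise bounds. *)
Definition spread (p : V) : R := \sum_i mu i * ((p \in supp i)%:R / #|supp i|%:R).

Lemma xsum_spread A : xsum spread A = \sum_i mu i * share A (supp i).
Proof.
rewrite /xsum exchange_big /=; apply: eq_bigr => i _.
rewrite -mulr_sumr -mulr_suml; congr (_ * (_ / _)).
rewrite -natr_sum; congr _%:R.
rewrite -sum1_card (eq_bigl _ _ (fun p => in_setI p A _)) big_mkcondr.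
by apply: eq_bigr => p _; case: (p \in _).
Qed.

Hypothesis supp_sub : forall i, supp i \subset T i.
Hypothesis supp_neq0 : forall i, T i != set0 -> supp i != set0.
Hypothesis mu_bnd : forall i, 1 <= mu i <= 2.

Lemma spread_low_term A i :
  [&& T i \subset setT, T i :&: setT != set0 & T i :&: setT \subset A]%:R
    <= mu i * share A (supp i).
Proof.
have /andP[mu1 _] := mu_bnd i; rewrite subsetT setIT /=.
have [/andP[T0 TA]|_] := boolP (_ && _).
  by rewrite share1 ?mulr1 ?supp_neq0 // (subset_trans (supp_sub i)).
by rewrite mulr_ge0 ?share_ge0 // (le_trans ler01).
Qed.

Lemma spread_up_term A i :
  mu i * share A (supp i) <= 2 * ((T i \subset setT) && (T i :&: A != set0))%:R.
Proof.
have /andP[mu1 mu2] := mu_bnd i; rewrite subsetT /=.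
have [/eqP TA|TA] := boolP (T i :&: A == set0).
  rewrite share0 ?mulr0 //; apply/eqP; rewrite -subset0 -TA setIC.
  exact: setSI (supp_sub i).
have := share_le1 A (supp i); have := share_ge0 A (supp i).
by rewrite mulr1; nra.
Qed.

Lemma low_lt_spread A :
  (exists i, [&& T i != set0, T i \subset A & 1 < mu i]
     \/ ~~ (T i \subset A) /\ A :&: supp i != set0) ->
  (low T setT setT A)%:R < xsum spread A.
Proof.
move=> [i strict]; rewrite xsum_spread natr_sum.
apply: ltr_sum_exists => [j|]; first exact: spread_low_term.
exists i => /=; rewrite subsetT setIT /=.
case: strict => [/and3P[T0 TA mu1]|[TA /share_gt0 sA]].
  by rewrite T0 TA share1 ?mulr1 ?supp_neq0 // (subset_trans (supp_sub i)).
rewrite (negPf TA) andbF mulr_gt0 //.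
by apply: lt_le_trans ltr01 _; case/andP: (mu_bnd i).
Qed.

Lemma spread_lt_up A :
  (exists i, T i :&: A != set0 /\ (mu i < 2 \/ ~~ (supp i \subset A))) ->
  xsum spread A < 2 * (up T setT A)%:R.
Proof.
move=> [i [TA strict]]; rewrite xsum_spread natr_sum mulr_sumr.
apply: ltr_sum_exists => [j|]; first exact: spread_up_term.
exists i; rewrite /= subsetT TA mulr1.
have := share_le1 A (supp i); have := share_ge0 A (supp i).
have /andP[mu1 _] := mu_bnd i.
by case: strict => [mu2|/share_lt1 sA]; [nra|move: (mu_bnd i) => /andP[_]; nra].
Qed.

End Spread.

Section Witnesses.
Variables (V I : finType) (T : I -> {set V}) (R : realFieldType).
Hypothesis singletons : forall p, exists i, T i = [set p].

Lemma interior_point : exists x : V -> R, forall A, A != set0 ->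
  (low T setT setT A)%:R < xsum x A < 2 * (up T setT A)%:R.
Proof.
exists (spread (fun=> 3 / 2) T) => A /set0Pn[p Ap].
have [i Ti] := singletons p.
have mu_bnd : 1 <= (3 / 2 : R) <= 2 by apply/andP; split; lra.
apply/andP; split.
  apply: low_lt_spread => //; exists i; left.
  by rewrite Ti -card_gt0 cards1 sub1set Ap /=; lra.
apply: spread_lt_up => //; exists i; split; last by left; lra.
by apply/set0Pn; exists p; rewrite Ti !inE eqxx.
Qed.

(** Sets inside [J] give 1, the others give 3/2 entirely outside [J], so [J] receives exactly its
    lower bound. Lower bounds are strict on proper subsets of [J] because [J] belongs to the family
    and gives them a positive share, and on the remaining sets because of a singleton outside
    [J]. *)
Lemma seg_facet_point J j : T j = J -> J != set0 ->
  exists x : V -> R, [/\ xsum x J = (low T setT setT J)%:R,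
    forall A, A != set0 -> A != J -> (low T setT setT A)%:R < xsum x A &
    forall A, A != set0 -> xsum x A < 2 * (up T setT A)%:R].
Proof.
move=> Tj J0; pose mu i : R := if T i \subset J then 1 else 3 / 2.
pose supp i := if T i \subset J then T i else T i :\: J.
have mu_bnd i : 1 <= mu i <= 2 by rewrite /mu; case: ifP => _; apply/andP; split; lra.
have supp_sub i : supp i \subset T i by rewrite /supp; case: ifP => // _; apply: subsetDl.
have supp_neq0 i : T i != set0 -> supp i != set0.
  by rewrite /supp; case: ifP => // TJ _; rewrite setD_eq0 TJ.
exists (spread mu supp); split=> [|A A0 AJ|A A0].
- rewrite xsum_spread natr_sum; apply: eq_bigr => i _; rewrite subsetT setIT /=.
  rewrite /mu /supp; case: ifP => TJ; last first.
    by rewrite andbF share0 ?mulr0 // setIDA setIC -setIDA setDv setI0.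
  rewrite andbT mul1r; have [->|T0] := eqVneq (T i) set0; first by rewrite share0 ?setI0.
  by rewrite share1.
- apply: low_lt_spread => //; have [sAJ|/subsetPn[p Ap Jp]] := boolP (A \subset J).
    exists j; right; rewrite /supp Tj subxx (setIidPl sAJ); split=> //.
    by apply: contraNN AJ => sJA; rewrite eqEsubset sAJ.
  have [i Ti] := singletons p; exists i; left.
  by rewrite Ti -card_gt0 cards1 sub1set Ap /mu Ti sub1set (negPf Jp) /=; lra.
apply: spread_lt_up => //; have [p Ap] := set0Pn _ A0.
have [i Ti] := singletons p; exists i; split; first by apply/set0Pn; exists p;
  rewrite Ti !inE eqxx.
by left; rewrite /mu; case: ifP => _; lra.
Qed.

(** Sets meeting [S] give 2, all of it to [S]; the others give 3/2. Upper bounds are strict on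
    proper subsets of [S] because the whole set belongs to the family and spreads over all of [S],
    and on the remaining sets because of a singleton outside [S]. *)
Lemma cut_facet_point S j : T j = setT -> S != set0 ->
  exists x : V -> R, [/\ xsum x S = 2 * (up T setT S)%:R,
    forall A, A != set0 -> (low T setT setT A)%:R < xsum x A &
    forall A, A != set0 -> A != S -> xsum x A < 2 * (up T setT A)%:R].
Proof.
move=> Tj S0; pose mu i : R := if T i :&: S != set0 then 2 else 3 / 2.
pose supp i := if T i :&: S != set0 then T i :&: S else T i.
have mu_bnd i : 1 <= mu i <= 2 by rewrite /mu; case: ifP => _; apply/andP; split; lra.
have supp_sub i : supp i \subset T i by rewrite /supp; case: ifP => // _; apply: subsetIl.
have supp_neq0 i : T i != set0 -> supp i != set0 by rewrite /supp; case: ifP.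
exists (spread mu supp); split=> [|A A0|A A0 AS].
- rewrite xsum_spread natr_sum mulr_sumr; apply: eq_bigr => i _; rewrite subsetT /=.
  rewrite /mu /supp; case: ifP => [TS|/negbFE/eqP TS].
    by rewrite share1 // subsetIr.
  by rewrite share0 ?mulr0 // setIC.
- apply: low_lt_spread => //; have [p Ap] := set0Pn _ A0.
  have [i Ti] := singletons p; exists i; left.
  by rewrite Ti -card_gt0 cards1 sub1set Ap /mu; case: ifP => _ /=; lra.
apply: spread_lt_up => //; have [sAS|/subsetPn[p Ap Sp]] := boolP (A \subset S).
  exists j; rewrite Tj setTI; split=> //; right.
  rewrite /supp Tj setTI S0; apply: contraNN AS => sSA.
  by rewrite eqEsubset sAS.
have [i Ti] := singletons p; exists i; rewrite Ti; split.
  by apply/set0Pn; exists p; rewrite !inE eqxx.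
left; rewrite /mu Ti; have -> : [set p] :&: S = set0.
  by apply/eqP; rewrite setI_eq0 disjoints1.
by rewrite eqxx /=; lra.
Qed.

End Witnesses.

Require Import Defs.
From mathcomp Require Import all_classical all_reals all_analysis.
From mathcomp Require Import freeg.
Import numFieldNormedType.Exports.
(* The finite-set lemmas shadow their namesakes on classical sets. *)
Import fintype finset.

(** * Sums over pairs of weights *)

Section PairSums.
Variable R : realType.
Implicit Types (w : nat -> R) (G : nat -> nat -> bool).

(** Common form of all the bounds. Indices start at 0 although weights are numbered from 1; as
    [ent w 0] reads the first entry again, the relations applied to [ent w] exclude 0. *)
Definition pair_sum M w G : R := \sum_(k < M) \sum_(l < M) w k * w l * (G k l)%:R.

Lemma eq_pair_sum M w w' G G' :
    (forall k, (k < M)%N -> w k = w' k) ->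
    (forall k l, (k < M)%N -> (l < M)%N -> G k l = G' k l) ->
  pair_sum M w G = pair_sum M w' G'.
Proof.
move=> eq_w eq_G; apply: eq_bigr => k _; apply: eq_bigr => l _.
by rewrite !eq_w // eq_G.
Qed.

Lemma pair_sumD M w G1 G2 G3 :
    (forall k l, (k < M)%N -> (l < M)%N -> (G1 k l + G2 k l = G3 k l)%N) ->
  pair_sum M w G1 + pair_sum M w G2 = pair_sum M w G3.
Proof.
move=> eqG; rewrite /pair_sum -big_split; apply: eq_bigr => k _; rewrite -big_split.
by apply: eq_bigr => l _ /=; rewrite -mulrDr -natrD eqG.
Qed.

Lemma sum_widen (F : nat -> R) a b M : (b <= M)%N ->
  \sum_(a <= k < b) F k = \sum_(k < M) F k * ((a <= k < b)%N)%:R.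
Proof.
move=> le_bM; rewrite big_geq_mkord (big_ord_widen_cond _ (fun k => a <= k)%N F le_bM).
rewrite big_mkcond; apply: eq_bigr => k _.
by case: (a <= k)%N; case: (k < b)%N; rewrite ?mulr1 ?mulr0.
Qed.

Lemma nested_sum M w a b : (b <= M)%N ->
  \sum_(a <= k < b) \sum_(k + 1 <= l < b) w k * w l =
  pair_sum M w (fun k l => [&& a <= k, k < l & l < b]%N).
Proof.
move=> le_bM; rewrite (sum_widen _ _ le_bM); apply: eq_bigr => k _.
rewrite (sum_widen _ _ le_bM) mulr_suml; apply: eq_bigr => l _.
rewrite -mulrA -natrM mulnb; congr (_ * _%:R).
by congr nat_of_bool; lia.
Qed.

(* [P 0 < ... < P m] cuts the weights [w] into blocks [P (t - 1) < k <= P t]. *)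
Section Coarsening.
Variables (m : nat) (P : nat -> nat).
Hypothesis P_lt : forall t, (t < m)%N -> (P t < P t.+1)%N.

Lemma increasing_lt s t : (s < t <= m)%N -> (P s < P t)%N.
Proof.
case/andP; elim: t => // t IH; rewrite ltnS leq_eqVlt => /predU1P[->|lt_st] lt_tm.
  exact: P_lt.
by apply: ltn_trans (P_lt lt_tm); apply: IH => //; apply: ltnW.
Qed.

Lemma increasing_lt_iff s t : (s <= m)%N -> (t <= m)%N -> (P s < P t)%N = (s < t)%N.
Proof.
move=> le_sm le_tm; case: (ltngtP s t) => [st|ts|->]; last by rewrite ltnn.
  by apply: increasing_lt; rewrite st.
by apply/negbTE; rewrite -leqNgt; apply/ltnW/increasing_lt; rewrite ts.
Qed.

Definition block t k := (P t.-1 < k <= P t)%N.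

Lemma block_exists k : (P 0 < k <= P m)%N -> exists2 t, (0 < t <= m)%N & block t k.
Proof.
have : (m <= m)%N by []; elim: {-2}m => [|j IH] lt_jm; first lia.
case: (ltnP (P j) k) => [lt_k /andP[_ le_k]|le_k /andP[lt_k _]].
  by exists j.+1; rewrite /block ?lt_k /= ?leqnn.
have [|t t_j blk] := IH (ltnW lt_jm); first by rewrite lt_k.
by exists t => //; case/andP: t_j => -> /leqW ->.
Qed.

Lemma block_lt t k s :
  (0 < t <= m)%N -> (s <= m)%N -> block t k -> (P s < k)%N = (s < t)%N.
Proof.
move=> /andP[t0 tm] sm /andP[lt_k le_k]; case: (ltnP s t) => [st|ts].
  apply: leq_ltn_trans lt_k; rewrite leqNgt increasing_lt_iff //; lia.
apply/negbTE; rewrite -leqNgt (leq_trans le_k) // leqNgt increasing_lt_iff //; lia.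
Qed.

Lemma block_uniq t t' k : (0 < t <= m)%N -> (0 < t' <= m)%N ->
  block t k -> block t' k -> t = t'.
Proof.
move=> tm t'm blk blk'.
have := block_lt (s := t.-1) t'm _ blk'; have := block_lt (s := t.-1) tm _ blk.
have := block_lt (s := t'.-1) t'm _ blk'; have := block_lt (s := t'.-1) tm _ blk.
lia.
Qed.

(** Expanding [wbar t * wbar u] yields each pair of fine weights in range exactly once, since every
    index in range lies in exactly one block. Both [Omega] and the weights of the factors of a facet
    are such block sums. *)
Lemma coarsening M w wbar F G : (P m < M)%N ->
    (forall t, (0 < t <= m)%N -> wbar t = \sum_(k < M) w k * (block t k)%:R) ->
    (forall t u k l, (0 < t <= m)%N -> (0 < u <= m)%N -> block t k -> block u l ->
       G k l = F t u) ->
    (forall k l, G k l -> (P 0 < k <= P m)%N && (P 0 < l <= P m)%N) ->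
  pair_sum M w G = pair_sum m.+1 wbar (fun t u => [&& 0 < t, 0 < u & F t u]%N).
Proof.
move=> lt_PM def_wbar GF G_range.
pose B t k := ((0 < t)%N && block t k)%:R : R.
transitivity (\sum_(t < m.+1) \sum_(u < m.+1) \sum_(k < M) \sum_(l < M)
    w k * w l * (B t k * B u l * (F t u)%:R)); last first.
  apply: eq_bigr => t _; apply: eq_bigr => u _.
  have [t0|t_gt0] := posnP t.
    rewrite t0 /= mulr0 big1 // => k _; rewrite big1 // => l _.
    by rewrite /B /= !mul0r mulr0.
  have [u0|u_gt0] := posnP u.
    rewrite u0 /= mulr0 big1 // => k _; rewrite big1 // => l _.
    by rewrite /B /= mulr0 mul0r mulr0.
  have tm : (0 < t <= m)%N by rewrite t_gt0 -ltnS ltn_ord.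
  have um : (0 < u <= m)%N by rewrite u_gt0 -ltnS ltn_ord.
  rewrite (def_wbar t tm) (def_wbar u um) /= mulr_suml mulr_suml.
  apply: eq_bigr => k _; rewrite mulr_sumr mulr_suml; apply: eq_bigr => l _.
  by rewrite /B t_gt0 u_gt0 /=; ring.
have swap (H : 'I_m.+1 -> 'I_m.+1 -> 'I_M -> 'I_M -> R) :
    \sum_t \sum_u \sum_k \sum_l H t u k l = \sum_k \sum_l \sum_t \sum_u H t u k l.
  under eq_bigr do rewrite exchange_big; rewrite exchange_big; apply: eq_bigr => k _.
  under eq_bigr do rewrite exchange_big; rewrite exchange_big; apply: eq_bigr => l _.
  exact: eq_bigr.
rewrite swap; apply: eq_bigr => k _; apply: eq_bigr => l _.
under [RHS]eq_bigr do rewrite -mulr_sumr; rewrite -mulr_sumr; congr (_ * _).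
have Bout k' : ~~ (P 0 < k' <= P m)%N -> forall t : 'I_m.+1, B t k' = 0.
  move=> out t; rewrite /B; case: posnP => //= t_gt0.
  have [/andP[lt_k le_k]|//] := boolP (block t k'); case/negP: out.
  have lt_t := ltn_ord t; have := increasing_lt_iff (s := t.-1) (t := 0);
    have := increasing_lt_iff (s := m) (t := t).
  lia.
have [k_in|k_out] := boolP (P 0 < k <= P m)%N; last first.
  rewrite big1 => [|t _]; last by rewrite big1 // => u _; rewrite (Bout k) // !mul0r.
  by case: (boolP (G k l)) => // /G_range; rewrite (negPf k_out).
have [l_in|l_out] := boolP (P 0 < l <= P m)%N; last first.
  rewrite big1 => [|t _]; last by rewrite big1 // => u _; rewrite (Bout l) // mulr0 mul0r.
  by case: (boolP (G k l)) => // /G_range; rewrite (negPf l_out) andbF.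
have B1 k' t : (0 < t <= m)%N -> block t k' ->
    forall s : 'I_m.+1, B s k' = (s == inord t)%:R.
  move=> tm blk s; rewrite /B -val_eqE /= inordK; last by case/andP: tm.
  case: (posnP s) => [s0|s_gt0 /=]; first by case: eqP => // st; move: tm; rewrite -st s0.
  congr _%:R; congr nat_of_bool; apply/idP/eqP => [blk'|->//].
  by apply: block_uniq blk' blk; rewrite // s_gt0 -ltnS ltn_ord.
have [t tm blk_t] := block_exists k_in; have [u um blk_u] := block_exists l_in.
rewrite (bigD1 (inord t)) //= [X in _ = _ + X]big1 ?addr0 => [|s /negPf st]; last first.
  by rewrite big1 // => v _; rewrite (B1 k t) // st !mul0r.
rewrite (bigD1 (inord u)) //= [X in _ = _ + X]big1 ?addr0 => [|s /negPf st]; last first.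
  by rewrite (B1 l u) // st mulr0 mul0r.
rewrite (B1 k t) // (B1 l u) // !eqxx !mul1r (GF t u) // !inordK //.
  by case/andP: um.
by case/andP: tm.
Qed.

End Coarsening.

End PairSums.

(** * From intervals and compositions to arbitrary sets of coordinates *)

Section Characterization.
Variable R : realType.
Implicit Types (w Y F : nat -> R) (A : pred nat).

Lemma sum_widen_cond F A a b M : (b <= M)%N ->
  \sum_(a <= k < b | A k) F k = \sum_(k < M) F k * ((a <= k < b)%N && A k)%:R.
Proof.
move=> le_bM; rewrite big_mkcond (sum_widen _ _ le_bM); apply: eq_bigr => k _.
by case: (A k); rewrite ?andbT ?andbF ?mulr0 ?mul0r.
Qed.

Lemma all_iotaP A k l :
  reflect (forall t, (k <= t < l)%N -> A t) (all A (index_iota k l)).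
Proof.
by apply: (iffP allP) => H t;
  [rewrite -mem_index_iota => /H | rewrite mem_index_iota => /H].
Qed.

Lemma has_iotaP A k l :
  reflect (exists2 t, (k <= t < l)%N & A t) (has A (index_iota k l)).
Proof.
by apply: (iffP hasP) => -[t t_kl At]; exists t;
  rewrite // ?mem_index_iota // -mem_index_iota.
Qed.

(** The pair [k < l] stands for the interval of coordinates listed by [index_iota k l], which stops
    at [l - 1]. *)
Definition inside m A k l := [&& (0 < k)%N, (k < l)%N,
  (l <= m)%N & all A (index_iota k l)].
Definition meets m A k l := [&& (0 < k)%N, (k < l)%N,
  (l <= m)%N & has A (index_iota k l)].

Lemma inside_interval m a b k l : (0 < a)%N -> (b <= m)%N ->
  inside m (fun t => a <= t < b)%N k l = [&& (a <= k)%N, (k < l)%N & (l <= b)%N].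
Proof.
move=> a_gt0 le_bm; apply/and4P/and3P =>
  [[k_gt0 lt_kl le_lm /all_iotaP all_kl] | [le_ak lt_kl le_lb]].
  have := all_kl k; have := all_kl l.-1; split=> //; lia.
by split; rewrite ?(leq_trans _ le_ak) ?(leq_trans le_lb) //; apply/all_iotaP => t; lia.
Qed.

(** [A] is a disjoint union of maximal runs, and an interval inside [A] lies in exactly one of them.
    Hence the lower bounds on intervals, the only ones in the definitions of the polytopes, imply
    those on all sets. *)
Lemma inside_sum m w Y :
    (forall a b, (0 < a < b)%N -> (b <= m)%N ->
      pair_sum m.+1 w (fun k l => [&& (a <= k)%N, (k < l)%N & (l <= b)%N])
        <= \sum_(a <= t < b) Y t) ->
  forall A, pair_sum m.+1 w (inside m A) <= \sum_(1 <= t < m | A t) Y t.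
Proof.
move=> bnd A; have bnd' a b : (0 < a <= b)%N -> (b <= m)%N ->
    pair_sum m.+1 w (fun k l =>
      [&& (a <= k)%N, (k < l)%N & (l <= b)%N]) <= \sum_(a <= t < b) Y t.
  move=> ab bm; have [lt_ab|le_ba] := ltnP a b; first by apply: bnd => //; lia.
  rewrite big_geq // /pair_sum big1 // => k _; rewrite big1 // => l _.
  by rewrite (_ : [&& _, _ & _] = false) ?mulr0 //; lia.
(* Here [a] descends inside the run that ends before [b]. When a coordinate [a] outside [A] is met,
   the run from [a + 1] is split off and the descent restarts with [b = a]. *)
suff tail a b : (0 < a <= b)%N -> (b <= m)%N -> all A (index_iota a b) ->
    pair_sum m.+1 w (inside b A) <= \sum_(1 <= t < b | A t) Y t.
  have [->|m_gt0] := posnP m; last by apply: (tail m m);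
    rewrite ?m_gt0 //= /index_iota subnn.
  rewrite big_geq // /pair_sum big1 // => k _; rewrite big1 // => l _.
  by rewrite /inside (_ : [&& _, _, _ & _] = false) ?mulr0 //; lia.
elim: a b => // a IH b ab bm all_ab; have [a0|a_gt0] := posnP a.
  rewrite {}a0 in ab all_ab;
    rewrite (_ : pair_sum _ _ _ = pair_sum m.+1 w (fun k l =>
    [&& (1 <= k)%N, (k < l)%N & (l <= b)%N])).
    rewrite big_mkcond (eq_big_nat _ _ (F2 := Y)) => [|t t_b]; first exact: bnd'.
    by have /all_iotaP -> := all_ab.
  apply: eq_pair_sum => // k l _ _; rewrite /inside; case: (posnP k) => [->//|k_gt0] /=.
  case: ltnP => //= kl; case: leqP => //= lb; apply/all_iotaP => t t_kl.
  by apply: (all_iotaP _ _ _ all_ab); lia.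
have [Aa|nAa] := boolP (A a).
  apply: IH => //; first lia.
  apply/all_iotaP => t /andP[]; rewrite leq_eqVlt => /predU1P[<-//|lt_at lt_tb].
  by apply: (all_iotaP _ _ _ all_ab); lia.
have := IH a _ _ _; rewrite /index_iota subnn => /(_ _ _ isT) IHa.
have := bnd' a.+1 b ab bm.
have eq_sum : \sum_(1 <= t < b | A t) Y t =
    \sum_(1 <= t < a | A t) Y t + \sum_(a.+1 <= t < b) Y t.
  rewrite (big_cat_nat _ (n := a)) //=; [congr (_ + _) | lia].
  rewrite big_ltn_cond ?(negPf nAa); last lia.
  rewrite big_mkcond; apply: eq_big_nat => t t_ab.
  by have /all_iotaP -> := all_ab.
have split_pairs : pair_sum m.+1 w (inside a A) +
    pair_sum m.+1 w (fun k l =>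
      [&& (a.+1 <= k)%N, (k < l)%N & (l <= b)%N]) = pair_sum m.+1 w (inside b A).
  apply: pair_sumD => k l _ _; rewrite /inside.
  have [le_la|lt_al] := leqP l a.
    have -> : (l <= b)%N by lia.
    by rewrite (_ : [&& a < k, k < l & true]%N = false) ?addn0 //; lia.
  rewrite /= !andbF add0n; congr nat_of_bool.
  have [lt_ak|le_ka] := ltnP a k.
    have -> /= : (0 < k)%N by lia.
    case: ltnP => //= kl; case: leqP => //= lb; symmetry; apply/all_iotaP => t t_kl.
    by apply: (all_iotaP _ _ _ all_ab); lia.
  have -> : all A (index_iota k l) = false.
    by apply/negbTE/all_iotaP => /(_ a); rewrite le_ka lt_al (negPf nAa) => /(_ isT).
  by rewrite !andbF.
have := IHa _ _; rewrite eq_sum -split_pairs => IHa'.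
by move=> ?; apply: lerD => //; apply: IHa'; lia.
Qed.

Section Cuts.
Variables (m : nat) (P : nat -> nat).
Hypothesis P_lt : forall t, (t < m)%N -> (P t < P t.+1)%N.

Definition cut_in A p := has (fun t => A t && (P t == p)) (index_iota 1 m).

Lemma block_position t u k l s : (0 < t <= m)%N -> (0 < u <= m)%N -> (s <= m)%N ->
  block P t k -> block P u l -> (k <= P s < l)%N = (t <= s < u)%N.
Proof.
move=> tm um sm blk_t blk_u.
by rewrite leqNgt (block_lt P_lt tm) // (block_lt P_lt um) // -leqNgt.
Qed.

Lemma sum_cuts A F N : (P m <= N)%N ->
  \sum_(1 <= t < m | A t) F (P t) = \sum_(p < N) F p * (cut_in A p)%:R.
Proof.
move=> le_PN.
transitivity (\sum_(1 <= t < m | A t) \sum_(p < N) F p * (P t == p)%:R).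
  rewrite big_nat_cond [RHS]big_nat_cond; apply: eq_bigr => t /andP[/andP[t1 tm] _].
  have lt_PN : (P t < N)%N by apply: leq_trans le_PN; apply: (increasing_lt P_lt);
    rewrite tm leqnn.
  rewrite (bigD1 (Ordinal lt_PN)) //= eqxx mulr1 big1 ?addr0 // => p.
  by rewrite -val_eqE /= eq_sym => /negPf->; rewrite mulr0.
rewrite exchange_big; apply: eq_bigr => p _ /=; rewrite -mulr_sumr; congr (_ * _).
have [/hasP[t]|no_t] := boolP (cut_in A p).
  rewrite mem_index_iota => tm /andP[At /eqP Pt].
  rewrite big_mkcond (bigD1_seq t) ?iota_uniq ?mem_index_iota //= At Pt eqxx.
  rewrite big_nat_cond big1 ?addr0 // => s /andP[sm st].
  case: ifP => // _; case: eqP => // Ps; case/negP: st; apply/eqP.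
  have := increasing_lt_iff P_lt (s := s) (t := t);
    have := increasing_lt_iff P_lt (s := t) (t := s).
  rewrite Ps Pt ltnn; lia.
rewrite big_nat_cond big1 // => t /andP[tm At]; case: eqP => // Pt.
by case/hasP: no_t; exists t; rewrite ?mem_index_iota // At Pt /=.
Qed.

End Cuts.

End Characterization.

Definition partial_sum (i : seq nat) (t : nat) : nat := sumn (take t i).

Section Compositions.
Variable R : realType.

Lemma partial_sumS i t :
  (t < size i)%N -> partial_sum i t.+1 = (partial_sum i t + nth 0%N i t)%N.
Proof. by move=> ti; rewrite /partial_sum (take_nth 0%N) // sumn_rcons. Qed.

Lemma partial_sum_lt m i : composition m i ->
  forall t, (t < size i)%N -> (partial_sum i t < partial_sum i t.+1)%N.
Proof.
case/andP=> _ /allP i_gt0 t ti; rewrite partial_sumS // -[ltnLHS]addn0 ltn_add2l.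
by apply: i_gt0; rewrite mem_nth.
Qed.

Lemma partial_sum_size m i : composition m i -> partial_sum i (size i) = m.
Proof. by case/andP=> /eqP <- _; rewrite /partial_sum take_size. Qed.

Definition cuts i : pred nat := cut_in (size i) (partial_sum i) predT.

Lemma cuts_range m i p : composition m i -> cuts i p -> (0 < p < m)%N.
Proof.
move=> comp_i /hasP[t]; rewrite mem_index_iota => /andP[t1 ti] /andP[_ /eqP <-].
have P_lt := partial_sum_lt comp_i.
have := increasing_lt P_lt (s := 0) (t := t);
  have := increasing_lt P_lt (s := t) (t := size i).
rewrite (partial_sum_size comp_i); lia.
Qed.

Lemma Omega_block m (w : seq R) i t : composition m i -> (0 < t <= size i)%N ->
  Omega w i t = \sum_(k < m.+1) ent w k * (block (partial_sum i) t k)%:R.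
Proof.
move=> comp_i /andP[t_gt0 ti]; have P_lt := partial_sum_lt comp_i.
have le_m : (partial_sum i t <= m)%N.
  rewrite -(partial_sum_size comp_i) leqNgt (increasing_lt_iff P_lt) //; lia.
rewrite /Omega -/(partial_sum i t.-1).
have sum_t : (partial_sum i t.-1 + nth 0%N i t.-1)%N = partial_sum i t.
  by rewrite -partial_sumS prednK.
transitivity (\sum_((partial_sum i t.-1).+1 <= k < (partial_sum i t).+1) ent w k).
  rewrite -[(partial_sum i t.-1).+1]add1n big_addn (_ : _ - _ = (nth 0%N i t.-1).+1)%N;
    last lia.
  by apply: eq_bigr => a _; rewrite addnC.
exact: sum_widen.
Qed.

Lemma meets_cuts m i t u k l : composition m i ->
    (0 < t <= size i)%N -> (0 < u <= size i)%N ->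
    block (partial_sum i) t k -> block (partial_sum i) u l ->
  meets m (cuts i) k l = (t < u)%N.
Proof.
move=> comp_i ti ui blk_t blk_u; have P_lt := partial_sum_lt comp_i.
have range s k' : (0 < s <= size i)%N -> block (partial_sum i) s k' -> (0 < k' <= m)%N.
  move=> /andP[s0 si] /andP[lt_k le_k]; rewrite (leq_ltn_trans _ lt_k) //=.
  apply: leq_trans le_k _;
    rewrite -(partial_sum_size comp_i) leqNgt (increasing_lt_iff P_lt) //; lia.
have /andP[k0 km] := range _ _ ti blk_t; have /andP[l0 lm] := range _ _ ui blk_u.
rewrite /meets k0 lm /=; apply/andP/idP => [[lt_kl /has_iotaP[p pkl /hasP[s]]] | lt_tu].
  rewrite mem_index_iota => /andP[s1 si] /andP[_ /eqP Ps]; rewrite -Ps in pkl.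
  have := block_position P_lt (s := s) ti ui (ltnW si) blk_t blk_u; rewrite pkl.
  by move/esym; lia.
have tsize : (t < size i)%N by lia.
have pos := block_position P_lt (s := t) ti ui (ltnW tsize) blk_t blk_u.
rewrite leqnn lt_tu in pos; case/andP: (pos) => le_k lt_l; split; first lia.
apply/has_iotaP; exists (partial_sum i t) => //; apply/hasP; exists t;
  last by rewrite /= eqxx.
by rewrite mem_index_iota tsize; case/andP: ti => ->.
Qed.

(** Two weights lie in different parts exactly when their interval contains a cut, so expanding the
    [Omega] gives the pairs that meet [cuts i]. *)
Lemma cut_boundE m (w : seq R) i : composition m i ->
  cut_bound w i = 2 * pair_sum m.+1 (ent w) (meets m (cuts i)).
Proof.
move=> comp_i; rewrite /cut_bound; congr (_ * _).
have P_lt := partial_sum_lt comp_i.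
rewrite (nested_sum _ 1 (leqnn (size i).+1)).
rewrite [RHS](coarsening P_lt (F := fun t u => (t < u)%N) (wbar := Omega w i)).
- by apply: eq_pair_sum => // t u _ ui; lia.
- by rewrite (partial_sum_size comp_i).
- by move=> t ti; apply: Omega_block.
- by move=> t u k l; apply: meets_cuts.
move=> k l; rewrite (partial_sum_size comp_i) /partial_sum take0 /=.
by rewrite /meets => /and4P[]; lia.
Qed.

Lemma cut_sumE m i (y : 'rV[R]_m.-1) : composition m i ->
  cut_sum i y = \sum_(1 <= t < m | cuts i t) ent (coords y) t.
Proof.
move=> comp_i; have P_lt := partial_sum_lt comp_i.
have le_Pm : (partial_sum i (size i) <= m)%N by rewrite (partial_sum_size comp_i).
rewrite /cut_sum (sum_cuts P_lt predT _ le_Pm).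
rewrite (sum_widen_cond _ _ _ (leqnn m)); apply: eq_bigr => p _.
rewrite -/(cuts i p); congr (_ * _%:R); congr nat_of_bool.
by case: (boolP (cuts i p)) => [/(cuts_range comp_i)->|]; rewrite ?andbF.
Qed.

(** The parts are the gaps between consecutive elements of 0, [A], [m]. Thus bounds indexed by
    compositions are bounds indexed by sets of coordinates, the empty set being the composition with
    one part. *)
Lemma composition_of m (A : pred nat) : (0 < m)%N ->
  exists2 i, composition m i & forall t, (0 < t < m)%N -> cuts i t = A t.
Proof.
pose s := [seq t <- index_iota 1 m | A t]; pose gaps := pairmap (fun a b => (b - a)%N).
move=> m_gt0; have sorted_s : path ltn 0%N (rcons s m).
  rewrite rcons_path; apply/andP; split.
    apply: path_filter; first exact: ltn_trans.
    by rewrite /index_iota -[path _ _ _]/(sorted ltn (iota 0 (m - 1).+1)) iota_ltn_sorted.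
  have: last 0%N s \in 0%N :: s by apply: mem_last.
  by rewrite inE mem_filter mem_index_iota => /predU1P[->//|/and3P[]].
have gap_sum l a t : path ltn a l -> (t <= size l)%N ->
    (a + partial_sum (gaps a l) t)%N = nth 0%N (a :: l) t.
  elim: l a t => [|b l IH] a [|t] //=; rewrite ?addn0 // => /andP[ab pl] tl.
  by rewrite /partial_sum /= addnA subnKC ?(ltnW ab) // IH.
have gaps_gt0 l a : path ltn a l -> all (leq 1) (gaps a l).
  by elim: l a => //= b l IH a /andP[ab /IH->]; rewrite andbT subn_gt0.
have size_g : size (gaps 0%N (rcons s m)) = (size s).+1 by rewrite size_pairmap
  size_rcons.
exists (gaps 0%N (rcons s m)).
  apply/andP; split.
    have := gap_sum _ _ (size s).+1 sorted_s.
    rewrite size_rcons leqnn add0n /partial_sum -size_g take_size => -> //.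
    by rewrite size_g /= nth_rcons ltnn eqxx.
  exact: gaps_gt0.
move=> t tm; apply/hasP/idP => [[k] | At].
  rewrite size_g mem_index_iota => k_s /andP[_ /eqP].
  rewrite -[partial_sum _ _]add0n gap_sum ?size_rcons //; last lia.
  case: k k_s => // k k_s /=; rewrite nth_rcons ifT; last lia.
  by move=> <-; have := mem_nth 0%N (n := k) (s := s) k_s; rewrite mem_filter => /andP[].
have s_t : t \in s by rewrite mem_filter At mem_index_iota.
have lt_t : (index t s < size s)%N by rewrite index_mem.
exists (index t s).+1; first by rewrite size_g mem_index_iota; lia.
rewrite /= -[partial_sum _ _]add0n gap_sum ?size_rcons //; last lia.
by rewrite /= nth_rcons lt_t nth_index.
Qed.

Lemma seg_boundE m (w : seq R) i1 i2 : (i1 + i2 <= m)%N ->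
  seg_bound w i1 i2 =
  pair_sum m.+1 (ent w) (fun k l => [&& (i1 < k)%N, (k < l)%N & (l <= i1 + i2)%N]).
Proof.
move=> le_m; rewrite /seg_bound (nested_sum _ _ (M := m.+1)) //.
by apply: eq_pair_sum => // k l _ _; rewrite addn1.
Qed.

Lemma seg_bound_inside m (w : seq R) i1 i2 : (i1 + i2 <= m)%N ->
  seg_bound w i1 i2 =
  pair_sum m.+1 (ent w) (inside m (fun t => (i1 < t)%N && (t < i1 + i2)%N)).
Proof.
move=> le_m; rewrite (seg_boundE _ le_m); apply: eq_pair_sum => // k l _ _.
by rewrite inside_interval.
Qed.

Lemma seg_sumE m i1 i2 (y : 'rV[R]_m.-1) : (i1 + i2 <= m)%N ->
  seg_sum i1 i2 y =
  \sum_(1 <= t < m | (i1 < t)%N && (t < i1 + i2)%N) ent (coords y) t.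
Proof.
move=> le_m; rewrite /seg_sum (sum_widen _ _ le_m) (sum_widen_cond _ _ _ (leqnn m)).
apply: eq_bigr => t _; congr (_ * _%:R); congr nat_of_bool.
by have := ltn_ord t; lia.
Qed.

Lemma inside_sum_iff m (w : m.-tuple R) (y : 'rV[R]_m.-1) :
  (forall i1 i2 i3 : nat, (i1 + i2 + i3 = m)%N -> (2 <= i2)%N ->
       seg_bound w i1 i2 <= seg_sum i1 i2 y) <->
  (forall A, pair_sum m.+1 (ent w) (inside m A) <= \sum_(1 <= t < m | A t) ent (coords
    y) t).
Proof.
split=> [bnd | bnd i1 i2 i3 sum_i _].
  apply: inside_sum => a b ab bm.
  have := bnd a.-1 (b - a).+1 (m - b)%N _ _; rewrite (seg_boundE (m := m)); last lia.
  rewrite /seg_sum (_ : a.-1 + 1 = a)%N; last lia.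
  rewrite (_ : a.-1 + (b - a).+1 = b)%N; last lia.
  rewrite (eq_pair_sum (w' := ent w) (G' := fun k l =>
    [&& (a <= k)%N, (k < l)%N & (l <= b)%N])) //.
    by apply; lia.
  by move=> k l _ _; rewrite prednK //; lia.
rewrite (seg_bound_inside (m := m)) ?seg_sumE; [exact: bnd | lia | lia].
Qed.

Lemma forcey_lodayP m (w : m.-tuple R) (y : 'rV[R]_m.-1) : (0 < m)%N ->
  forcey_loday w y <-> forall A, pair_sum m.+1 (ent w) (inside m A)
    <= \sum_(1 <= t < m | A t) ent (coords y) t <= 2 * pair_sum m.+1 (ent w) (meets m A).
Proof.
move=> m_gt0; split=> [[/inside_sum_iff lo hi] A | bnd].
  rewrite lo /=; have [i comp_i cutsA] := composition_of A m_gt0.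
  have -> : \sum_(1 <= t < m | A t) ent (coords y) t = cut_sum i y.
    rewrite (cut_sumE _ comp_i) [LHS]big_nat_cond [RHS]big_nat_cond.
    by apply: eq_bigl => t; case: (boolP (1 <= t < m)%N) => // /cutsA->.
  have -> : pair_sum m.+1 (ent w) (meets m A) = pair_sum m.+1 (ent w) (meets m (cuts i)).
    apply: eq_pair_sum => // k l _ _;
      apply/and4P/and4P => -[k0 kl lm /has_iotaP[t t_kl At]]; split=> //;
      by apply/has_iotaP; exists t => //; move: At; rewrite cutsA //;
      case/andP: t_kl => kt tl; rewrite (leq_trans k0 kt) (leq_trans tl lm).
  rewrite -(cut_boundE _ comp_i).
  (* A composition with fewer than two parts is absent from the definition; it has no cuts, and both
     sides are then 0. *)
  have [s_ge2|s_lt2] := leqP 2 (size i).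
    exact: (hi _ (in_tuple i)).
  have le1 : (size i <= 1)%N by exact: s_lt2.
  rewrite /cut_sum (big_geq le1) (cut_boundE _ comp_i).
  rewrite [pair_sum _ _ _]big1 ?mulr0 // => k _; rewrite big1 // => l _.
  rewrite /meets (_ : has _ _ = false) ?andbF ?mulr0 //.
  by apply/hasPn => t _; rewrite /cuts /cut_in /index_iota (_ : _ - 1 = 0)%N //; lia.
split; first by apply/inside_sum_iff => A; case/andP: (bnd A).
move=> s i s2 comp_i; rewrite (cut_sumE _ comp_i) (cut_boundE _ comp_i).
by case/andP: (bnd (cuts i)).
Qed.

(** The equation of the hyperplane supplies the lower bound on the full interval, which [loday]
    leaves out by requiring [i2 <= n - 1]. *)
Lemma lodayP m (w : m.-tuple R) (y : 'rV[R]_m.-1) :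
  loday w y <->
    \sum_(1 <= t < m) ent (coords y) t = pair_sum m.+1 (ent w) (inside m predT) /\
    forall A, pair_sum m.+1 (ent w) (inside m A) <= \sum_(1 <= t < m | A t) ent (coords
      y) t.
Proof.
have seg0 : seg_sum 0 m y = \sum_(1 <= t < m) ent (coords y) t by [].
have bound0 : seg_bound w 0 m = pair_sum m.+1 (ent w) (inside m predT).
  rewrite (seg_bound_inside (m := m)) //; apply: eq_pair_sum => // k l _ _.
  apply/and4P/and4P => -[k0 kl lm /all_iotaP all_kl]; split=> //;
    apply/all_iotaP => t //; lia.
split=> [[eq_y bnd] | [eq_y /inside_sum_iff bnd]].
  split; first by rewrite -seg0 eq_y.
  apply/inside_sum_iff => i1 i2 i3 sum_i i2_ge2.
  have [i2_lt|i2_ge] := ltnP i2 m; first by apply: bnd sum_i _; lia.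
  have -> : i1 = 0%N by lia.
  by rewrite (_ : i2 = m) ?eq_y //; lia.
split; first by rewrite seg0 eq_y.
by move=> i1 i2 i3 sum_i i2_b; apply: bnd sum_i _; case/andP: i2_b.
Qed.

End Compositions.

(** Numbered from 0: [(k, l)] corresponds to the pair of weights [k + 1], [l + 1]. If [l <= k] the
    set is empty, and neither [low] nor [up] counts it. *)
Definition interval_set N (kl : 'I_N.+1 * 'I_N.+1) : {set 'I_N} :=
  [set p : 'I_N | (kl.1 <= p < kl.2)%N].

Lemma nth_coords (R : realType) N (x : 'rV[R]_N) (p : 'I_N) : nth 0 (coords x) p = x 0 p.
Proof. by rewrite (nth_map p) ?size_enum_ord // nth_ord_enum. Qed.

Lemma size_coords (R : realType) N (x : 'rV[R]_N) : size (coords x) = N.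
Proof. by rewrite size_map size_enum_ord. Qed.

(** * Factors of a facet, embedded in the ambient coordinates *)

Section Factor.
Variables (R : realType) (N m : nat) (P : nat -> nat) (c : R) (x : 'rV[R]_N).
Hypothesis P_lt : forall t, (t < m)%N -> (P t < P t.+1)%N.
Hypothesis P_le : (P m <= N.+1)%N.
Implicit Types A : pred nat.

Let T := @interval_set N.

(** The coordinate [t] of a factor becomes the ambient coordinate [P t], and its weight [t] is [c]
    times the length of the block that ends at [P t]. The four kinds of factors are instances, and
    so is [J_n] itself, with [P] the identity. The shift [p.+1] passes from ordinals to coordinates
    numbered from 1. *)
Definition cut_set A : {set 'I_N} := [set p : 'I_N | cut_in m P A p.+1].
Definition span_set : {set 'I_N} := [set p : 'I_N | (P 0 <= p < (P m).-1)%N].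

Let M := cut_set predT.
Let D := span_set.

Lemma cut_set_sub A : cut_set A \subset M.
Proof.
apply/subsetP => p; rewrite !inE => /hasP[t t_in /andP[_ Pt]].
by apply/hasP; exists t.
Qed.

Lemma cut_set_surj (B : {set 'I_N}) : B \subset M -> exists A, B = cut_set A.
Proof.
move=> /subsetP sBM; exists (fun t => [exists p in B, P t == p.+1]).
apply/setP => p; rewrite [RHS]inE; apply/idP/hasP => [Bp | [t _]].
  have := sBM p Bp; rewrite inE => /hasP[t t_in /andP[_ Pt]].
  by exists t => //; rewrite Pt andbT; apply/existsP; exists p; rewrite Bp.
move=> /andP[/existsP[q /andP[Bq /eqP ->]]]; rewrite eqSS => /eqP/val_inj <-.
by [].
Qed.

Lemma cut_in_range A p : cut_in m P A p -> (P 0 < p < P m)%N.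
Proof.
move=> /hasP[t]; rewrite mem_index_iota => /andP[t1 tm] /andP[_ /eqP <-].
by rewrite !(increasing_lt P_lt) ?tm ?leqnn // t1 ltnW.
Qed.

Lemma sum_cut_set A :
  \sum_(1 <= t < m | A t) ent (coords x) (P t) = xsum (x 0) (cut_set A).
Proof.
rewrite (sum_cuts P_lt A (ent (coords x)) P_le) big_ord_recl /=.
case: (boolP (cut_in m P A 0)) => [/cut_in_range//|_];
  rewrite mulr0 add0r /xsum [RHS]big_mkcond.
apply: eq_bigr => p _; rewrite inE /ent /= nth_coords /bump /= add1n.
by case: (cut_in _ _ _ _); rewrite ?mulr1 ?mulr0.
Qed.

Lemma count_intervals (G : nat -> nat -> bool) (Q : pred {set 'I_N}) :
    (forall k l, G k l -> (0 < k)%N && (0 < l)%N) ->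
    (forall k l : 'I_N.+1, G k.+1 l.+1 = Q (T (k, l))) ->
  pair_sum N.+2 (fun=> c) G = c ^+ 2 * (count_sets T Q)%:R.
Proof.
move=> G_gt0 GQ; rewrite /pair_sum big_ord_recl /= big1 => [|l _]; last first.
  by case: (boolP (G 0%N l)) => [/G_gt0//|]; rewrite mulr0.
rewrite add0r /count_sets natr_sum mulr_sumr.
transitivity (\sum_(k < N.+1) \sum_(l < N.+1) c ^+ 2 * (Q (T (k, l)))%:R); last first.
  by rewrite pair_bigA; apply: eq_bigr => -[].
apply: eq_bigr => k _; rewrite big_ord_recl /=.
case: (boolP (G _ 0%N)) => [/G_gt0|_]; first by rewrite andbF.
rewrite mulr0 add0r; apply: eq_bigr => l _.
by rewrite /bump /= !add1n GQ expr2.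
Qed.

Lemma interval_sub_span k l : T (k, l) != finset.set0 ->
  (T (k, l) \subset D) = (P 0 <= k)%N && (l < P m)%N.
Proof.
case/set0Pn=> p; rewrite inE /= => /andP[kp pl].
apply/subsetP/andP => [sTD | [Pk lP] q]; last by rewrite !inE /=; lia.
have lt_kN : (k < N)%N by apply: leq_ltn_trans kp _.
have lt_lN : (l.-1 < N)%N by have := ltn_ord l; lia.
have := sTD (Ordinal lt_kN); have := sTD (Ordinal lt_lN).
rewrite !inE /= leqnn; move: kp pl lt_kN lt_lN.
by move: (nat_of_ord p) (nat_of_ord k) (nat_of_ord l) => p' k' l'; lia.
Qed.

Lemma has_interval A (k l : 'I_N.+1) :
  has (cut_in m P A) (index_iota k.+1 l.+1) = (T (k, l) :&: cut_set A != finset.set0).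
Proof.
apply/has_iotaP/set0Pn => [[p p_kl Ap] | [p]].
  have lt_pN : (p.-1 < N)%N by have := ltn_ord l; lia.
  by exists (Ordinal lt_pN); rewrite !inE /= prednK //; [rewrite Ap andbT; lia | lia].
by rewrite !inE /= => /andP[kpl Ap]; exists p.+1 => //; lia.
Qed.

Variables (w : m.-tuple R) (y : 'rV[R]_m.-1).
Hypothesis w_block : forall t, (0 < t <= m)%N -> ent w t = c * (P t - P t.-1)%:R.
Hypothesis y_cut : forall t, (0 < t < m)%N -> ent (coords y) t = ent (coords x) (P t).

Lemma sum_factor A :
  \sum_(1 <= t < m | A t) ent (coords y) t = xsum (x 0) (cut_set A).
Proof.
rewrite -sum_cut_set big_nat_cond [RHS]big_nat_cond.
by apply: eq_bigr => t /andP[/y_cut].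
Qed.

Lemma ent_block_sum t : (0 < t <= m)%N ->
  ent w t = \sum_(k < N.+2) c * (block P t k)%:R.
Proof.
move=> tm; rewrite w_block // -mulr_sumr; congr (_ * _).
have le_t : (P t <= P m)%N by rewrite leqNgt (increasing_lt_iff P_lt) //; lia.
transitivity (\sum_((P t.-1).+1 <= k < (P t).+1) (1 : R)).
  by rewrite big_const_nat iter_addr_0 subSS.
by rewrite (sum_widen _ _ (M := N.+2)) ?ltnS ?(leq_trans le_t) //;
  apply: eq_bigr => k _; rewrite mul1r.
Qed.

Lemma cut_in_block A t u k l p : (0 < t <= m)%N -> (0 < u <= m)%N ->
    block P t k -> block P u l ->
  reflect (exists2 s, (t <= s < u)%N && A s & P s = p) ((k <= p < l)%N && cut_in m P A p).
Proof.
move=> tm um blk_t blk_u;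
  have pos s sm := @block_position m P P_lt t u k l s tm um sm blk_t blk_u.
apply: (iffP andP) => [[pkl /hasP[s]] | [s /andP[stu As] <-]].
  rewrite mem_index_iota => /andP[s1 sm] /andP[As /eqP Ps].
  by exists s => //; rewrite As andbT -(pos s (ltnW sm)) Ps.
rewrite pos; last lia; split=> //; apply/hasP; exists s; last by rewrite As eqxx.
by rewrite mem_index_iota; lia.
Qed.

(** For unit weights in the blocks [t < u], the cuts in their interval are the [P s] with
    [t <= s < u]. So the interval from [t] to [u - 1] of the factor lies in [A] iff the trace on [M]
    of the unit interval lies in the image of [A]. Pairs within one block have empty trace, which
    [low] discards. *)
Lemma pair_sum_inside A :
  pair_sum m.+1 (ent w) (inside m A) = c ^+ 2 * (low T D M (cut_set A))%:R.
Proof.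
pose G k l := [&& (P 0 < k)%N, (k < l)%N, (l <= P m)%N,
  has (cut_in m P predT) (index_iota k l) &
  all (fun p => cut_in m P predT p ==> cut_in m P A p) (index_iota k l)].
rewrite /low -(count_intervals (G := G)) => [|k l|k l]; first last.
- rewrite /G has_interval; have [->|T0] := eqVneq (T (k, l) :&: M) finset.set0.
    by rewrite !andbF.
  have Tkl : T (k, l) != finset.set0 by apply: contraNneq T0 => ->; rewrite finset.set0I.
  have kl : (k.+1 < l.+1)%N by case/set0Pn: Tkl => p; rewrite inE /=; lia.
  rewrite interval_sub_span // kl !andTb -andbA; congr [&& _, _ & _].
  apply/all_iotaP/subsetP => [all_A p | sub p pkl].
    by rewrite !inE /= => /andP[kpl Mp]; move/implyP: (all_A p.+1 kpl); apply.
  apply/implyP => Mp; have lt_pN : (p.-1 < N)%N by have := ltn_ord l; lia.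
  have := sub (Ordinal lt_pN); rewrite !inE /= prednK; last lia.
  by apply; rewrite Mp andbT; lia.
- by case/and5P; lia.
symmetry; rewrite (coarsening P_lt (wbar := ent w)
  (F := fun t u => (t < u)%N && all A (index_iota t u))).
- by apply: eq_pair_sum => // t u _ um; rewrite /inside; lia.
- by rewrite ltnS.
- exact: ent_block_sum.
- move=> t u k l tm um blk_t blk_u; rewrite /G.
  have tup := cut_in_block _ _ tm um blk_t blk_u.
  apply/and5P/andP => [[_ _ _ /has_iotaP[p pkl Mp] /all_iotaP all_A] | [lt_tu
    /all_iotaP all_A]].
    have /(tup predT p)[s stu Ps] : (k <= p < l)%N && cut_in m P predT p by rewrite pkl.
    split; first lia.
    apply/all_iotaP => s' s'tu.
    have /andP[pkl' Mp'] : (k <= P s' < l)%N && cut_in m P predT (P s').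
      by apply/tup; exists s' => //; rewrite s'tu.
    have /(tup A)[s'' /andP[s''tu As''] Ps''] : (k <= P s' < l)%N && cut_in m P A (P s').
      by rewrite pkl'; move/implyP: (all_A _ pkl'); apply.
    suff -> : s' = s'' by [].
    have := increasing_lt_iff P_lt (s := s') (t := s'');
      have := increasing_lt_iff P_lt (s := s'') (t := s').
    by rewrite Ps'' ltnn; lia.
  have /andP[pkl Mp] : (k <= P t < l)%N && cut_in m P predT (P t).
    by apply/tup; exists t => //; rewrite leqnn lt_tu.
  move: (blk_t) (blk_u) => /andP[lt_k le_k] /andP[lt_l le_l].
  have := increasing_lt_iff P_lt (s := t.-1) (t := 0);
    have := increasing_lt_iff P_lt (s := m) (t := u).
  split; [lia | lia | lia | by apply/has_iotaP; exists (P t) |].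
  apply/all_iotaP => p pkl'; apply/implyP => Mp'.
  have /(tup predT)[s /andP[stu _] Ps] :
    (k <= p < l)%N && cut_in m P predT p by rewrite pkl'.
  have /andP[_ //] : (k <= p < l)%N && cut_in m P A p.
  by apply/tup; exists s => //; rewrite stu all_A.
by move=> k l /and5P[]; lia.
Qed.

Lemma pair_sum_meets A :
  pair_sum m.+1 (ent w) (meets m A) = c ^+ 2 * (up T D (cut_set A))%:R.
Proof.
pose G k l := [&& (P 0 < k)%N, (k < l)%N, (l <= P m)%N &
  has (cut_in m P A) (index_iota k l)].
rewrite /up -(count_intervals (G := G)) => [|k l|k l]; first last.
- rewrite /G has_interval; have [_|T0] := eqVneq (T (k, l) :&: cut_set A) finset.set0.
    by rewrite /= !andbF.
  have Tkl : T (k, l) != finset.set0 by apply: contraNneq T0 => ->; rewrite finset.set0I.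
  have kl : (k.+1 < l.+1)%N by case/set0Pn: Tkl => p; rewrite inE /=; lia.
  by rewrite interval_sub_span // kl !andbT.
- by case/and4P; lia.
symmetry; rewrite (coarsening P_lt (wbar := ent w)
  (F := fun t u => (t < u)%N && has A (index_iota t u))).
- by apply: eq_pair_sum => // t u _ um; rewrite /meets; lia.
- by rewrite ltnS.
- exact: ent_block_sum.
- move=> t u k l tm um blk_t blk_u; rewrite /G.
  have tup := cut_in_block _ _ tm um blk_t blk_u.
  apply/and4P/andP => [[_ _ _ /has_iotaP[p pkl Ap]] | [lt_tu /has_iotaP[s stu As]]].
    have /(tup A p)[s /andP[stu As] Ps] : (k <= p < l)%N && cut_in m P A p by rewrite pkl.
    by split; [lia | apply/has_iotaP; exists s].
  have /andP[pkl Ap] : (k <= P s < l)%N && cut_in m P A (P s).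
    by apply/tup; exists s => //; rewrite stu.
  move: (blk_t) (blk_u) => /andP[lt_k le_k] /andP[lt_l le_l].
  have := increasing_lt_iff P_lt (s := t.-1) (t := 0);
    have := increasing_lt_iff P_lt (s := m) (t := u).
  by split; [lia | lia | lia | apply/has_iotaP; exists (P s)].
by move=> k l /and4P[]; lia.
Qed.

Lemma forcey_loday_factor : (0 < m)%N -> c = 1 ->
  forcey_loday w y <-> J_bounds T (x 0) D M.
Proof.
move=> m_gt0 c1; split=> [/(forcey_lodayP w y m_gt0) bnd B /cut_set_surj[A ->] | bnd].
  by have := bnd A; rewrite sum_factor pair_sum_inside pair_sum_meets c1 expr1n !mul1r.
apply/(forcey_lodayP w y m_gt0) => A.
by rewrite sum_factor pair_sum_inside pair_sum_meets c1 expr1n !mul1r;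
  apply/bnd/cut_set_sub.
Qed.

Lemma loday_factor : loday w y <-> K_bounds T (x 0) (c ^+ 2) D M.
Proof.
split=> [/lodayP[eq_y bnd] | [eq_x bnd]].
  split=> [|B /cut_set_surj[A ->]]; first by rewrite -sum_factor eq_y pair_sum_inside.
  by have := bnd A; rewrite sum_factor pair_sum_inside.
apply/lodayP; split=> [|A]; first by rewrite sum_factor eq_x pair_sum_inside.
by rewrite sum_factor pair_sum_inside; apply/bnd/cut_set_sub.
Qed.

End Factor.

(** * Polyhedra and boundary orientations *)

Local Open Scope classical_set_scope.
Local Open Scope ring_scope.

Lemma forcey_loday_basisE (R : realType) N :
  forcey_loday_basis R N = [seq fvec R N k | k <- iota 0 N].
Proof.
rewrite -val_enum_ord -map_comp; apply: eq_map => j /=.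
by apply/rowP => k; rewrite !mxE eqxx /= eq_sym.
Qed.

Section Polyhedron.
Variables (R : realType) (d : nat).
Implicit Types (x u v : 'rV[R]_d.+1) (a : 'cV[R]_d.+1).

Definition pairing a x : R := (x *m a) 0 0.

Lemma pairingD a x u : pairing a (x + u) = pairing a x + pairing a u.
Proof. by rewrite /pairing mulmxDl mxE. Qed.

Lemma pairingZ a t x : pairing a (t *: x) = t * pairing a x.
Proof. by rewrite /pairing -scalemxAl mxE. Qed.

Lemma pairingB a x u : pairing a (x - u) = pairing a x - pairing a u.
Proof. by rewrite -scaleN1r pairingD pairingZ mulN1r. Qed.

Lemma continuous_pairing a : continuous (pairing a).
Proof.
have -> : pairing a = (fun x => \sum_(j <- index_enum 'I_d.+1) x 0 j * a j 0).
  by apply/funext => x; rewrite /pairing mxE.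
elim: (index_enum _) => [|j s IH] x.
  by under eq_fun do rewrite big_nil; exact: (@cst_continuous _ R 0 x).
under eq_fun do rewrite big_cons.
have cj : (fun y : 'rV[R]_d.+1 =>
  y 0 j) y @[y --> x] --> x 0 j by exact: coord_continuous.
exact: (cvgD (cvgMr_tmp (b := a j 0) cj) (IH x)).
Qed.

Lemma nbhs_line x u (A : set 'rV[R]_d.+1) : nbhs x A ->
  exists2 e : R, 0 < e & forall t, `|t| < e -> A (x + t *: u).
Proof.
move=> nA; have line0 : x + t *: u @[t --> (0 : R)] --> x.
  rewrite -[X in _ --> X]addr0 -(scale0r u).
  by apply: cvgD; [exact: cvg_cst | apply: cvgZr_tmp; exact: cvg_id].
have /nbhs_ballP[e e_gt0 sub] := line0 _ nA.
exists e => // t te; apply: (sub t); rewrite /ball /= sub0r normrN //.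
Qed.

Variables (C : finType) (valid : pred C) (a : C -> 'cV[R]_d.+1) (c : C -> R).
Hypothesis a_neq0 : forall r, valid r -> a r != 0.

Definition polyhedron : set 'rV[R]_d.+1 :=
  [set x | forall r, valid r -> pairing (a r) x <= c r].

Lemma polyhedron_closed : closed polyhedron.
Proof.
have -> : polyhedron = \bigcap_(r in [set r | valid r]) [set x | pairing (a r) x <= c r].
  by apply/seteqP; split => x /= Px r; exact: Px.
apply: closed_bigI => r _;
  apply: (preimage_closed (f := pairing (a r))) (closed_le (y := c r)).
by move=> x _; exact: continuous_pairing.
Qed.

Lemma near_strict x (Q : pred C) : (forall r, Q r -> pairing (a r) x < c r) ->
  \forall y \near x, forall r, Q r -> pairing (a r) y < c r.
Proof.
move=> lt_x; suff near_r r : \forall y \near x, Q r -> pairing (a r) y < c r.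
  exact: (filter_forall _ near_r).
have [/lt_x lt_r|nQ] := boolP (Q r); last by near=> y => Qr; case/negP: nQ.
have near_lt : \forall y \near x, pairing (a r) y < c r.
  exact: (@cvgr_lt _ _ _ _ _ _ (@continuous_pairing (a r) x) _ lt_r).
by near=> y => _; near: y.
Unshelve. all: by end_near.
Qed.

Lemma pairing_gt0 r : valid r -> exists u, 0 < pairing (a r) u.
Proof.
move=> vr; have /cV0Pn[j aj] := a_neq0 vr; exists (\row_k (a r k 0)).
rewrite /pairing mxE (bigD1 j) //= mxE ltr_pwDl //.
  by rewrite -expr2 lt0r sqr_ge0 sqrf_eq0 aj.
by apply: sumr_ge0 => k _; rewrite mxE -expr2 sqr_ge0.
Qed.

(** A small step along a vector pairing positively with the normal stays in the polyhedron, so the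
    constraint is strict before the step; nonzero normals provide such vectors. *)
Lemma polyhedron_interior :
  polyhedron° = [set x | forall r, valid r -> pairing (a r) x < c r].
Proof.
apply/seteqP; split => x /= => [Px r vr | lt_x]; last first.
  rewrite /interior /=; apply: filterS (near_strict lt_x) => y lt_y r vr.
  exact/ltW/lt_y.
have [u u_gt0] := pairing_gt0 vr.
have [e e_gt0 sub] := nbhs_line u Px.
have := sub (e / 2); rewrite ger0_norm ?divr_ge0 // ?ltW // ltr_pdivrMr // => /(_ _ r vr).
rewrite pairingD pairingZ => le_c.
have /le_c : e < e * 2 by lra.
by apply: lt_le_trans; rewrite ltrDl mulr_gt0 // divr_gt0.
Qed.

Lemma polyhedron_frontier :
  frontier polyhedron =
  [set x | polyhedron x /\ exists2 r, valid r & pairing (a r) x = c r].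
Proof.
rewrite /frontier -(closure_id _).1; last exact: polyhedron_closed.
rewrite polyhedron_interior; apply/seteqP; split => x /= [Px ntight]; split=> //.
  apply: contrapT => notight; apply: ntight => r vr; rewrite lt_neqAle Px // andbT.
  by apply/eqP => eq_r; apply: notight; exists r.
by case: ntight => r vr eq_r /(_ r vr); rewrite eq_r ltxx.
Qed.

Lemma size_forcey_loday_basis : size (forcey_loday_basis R d.+1) = d.+1.
Proof. by rewrite size_map size_enum_ord. Qed.

Lemma det_forcey_loday_basis : rows_det (forcey_loday_basis R d.+1) = (-1) ^+ d.+1.
Proof. by rewrite forcey_loday_basisE rows_det_fvec. Qed.

Lemma span_full (l : seq 'rV[R]_d.+1) : size l = d.+1 -> rows_det l != 0 ->
  span l = fullv.
Proof.
move=> sz_l; rewrite -free_rows // => fr_l; apply/eqP.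
by rewrite eqEdim subvf dimvf (eqP fr_l) sz_l /= /dim /= mul1n.
Qed.

Lemma polyhedron_tangent x : (forall r, valid r -> pairing (a r) x < c r) ->
  tangent_basis polyhedron (forcey_loday_basis R d.+1).
Proof.
move=> lt_x; have Px : polyhedron x by move=> r vr; exact/ltW/lt_x.
have det_neq0 : rows_det (forcey_loday_basis R d.+1) != 0.
  by rewrite det_forcey_loday_basis signr_eq0.
split; [by exists x | by rewrite free_rows ?size_forcey_loday_basis | move=> U].
rewrite span_full ?size_forcey_loday_basis //; split=> [subU | /subvP fullU p q _ _].
  apply/subvP => u _; have [e e_gt0 sub] := nbhs_line u (near_strict lt_x).
  have te : `|e / 2| < e by rewrite ger0_norm ?divr_ge0 // ?ltW //; lra.
  have Pu : polyhedron (x + (e / 2) *: u) by move=> r vr; exact/ltW/sub.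
  have := subU _ _ Pu Px; rewrite addrC addKr rpredZeq.
  by rewrite gt_eqF ?divr_gt0.
by apply: fullU; rewrite memvf.
Qed.

Lemma rows_det_kernel (b : seq 'rV[R]_d.+1) h : h != 0 -> (size b <= d.+1)%N ->
  {in b, forall u, pairing h u = 0} -> rows_det b = 0.
Proof.
move=> h0 sz_b ker_b; apply/eqP/contraT => det0.
have : rows_mx b \in unitmx by rewrite unitmxE unitfE.
move=> /mulKmx/(_ h); suff -> : rows_mx b *m h = 0.
  by rewrite mulmx0 => /esym/eqP; rewrite (negPf h0).
apply/row_matrixP => i; rewrite row_mul rowK row0; apply/rowP => j.
rewrite [j]ord1 [RHS]mxE -[LHS]/(pairing h _).
have [lt_i|le_i] := ltnP i (size b); first by apply: ker_b; rewrite mem_nth.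
by rewrite nth_default // /pairing mul0mx mxE.
Qed.

Section Facet.
Variables (r0 : C) (p : 'rV[R]_d.+1).
Hypotheses (valid_r0 : valid r0) (p_tight : pairing (a r0) p = c r0).
Hypothesis p_strict : forall r, valid r && (r != r0) -> pairing (a r) p < c r.

Definition facet := polyhedron `&` [set x | pairing (a r0) x = c r0].

Lemma facet_line u : exists2 e : R, 0 < e & forall t, `|t| < e ->
  forall r, valid r -> r != r0 -> pairing (a r) (p + t *: u) < c r.
Proof.
have [e e_gt0 sub] := nbhs_line u (near_strict p_strict).
by exists e => // t /sub lt_r r vr r_r0; apply: lt_r; rewrite vr.
Qed.

Lemma facet_point : facet p.
Proof.
split=> // r vr; have [->|r_r0] := eqVneq r r0; first by rewrite p_tight.
by apply/ltW/p_strict; rewrite vr.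
Qed.

Lemma facet_outward v : 0 < pairing (a r0) v -> outward_pointing polyhedron p v.
Proof.
move=> v_gt0; have [e e_gt0 sub] := facet_line v; exists e => // t /andP[t_gt0 lt_te].
split.
  rewrite polyhedron_interior => r vr; have [->|r_r0] := eqVneq r r0.
    by rewrite pairingB pairingZ p_tight ltrBlDr ltrDl mulr_gt0.
  by rewrite -scaleNr; apply: sub => //; rewrite normrN gtr0_norm.
move=> /(_ r0 valid_r0); rewrite pairingD pairingZ p_tight.
by apply/negP; rewrite -ltNge ltrDl mulr_gt0.
Qed.

Lemma outward_facet q v : facet q -> outward_pointing polyhedron q v ->
  0 < pairing (a r0) v.
Proof.
move=> [_ /= q_tight] [e e_gt0 /(_ (e / 2))].
case; first by rewrite divr_gt0 //=; lra.
rewrite polyhedron_interior => /(_ r0 valid_r0).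
rewrite pairingB pairingZ q_tight ltrBlDr ltrDl => + _.
by rewrite pmulr_rgt0 // divr_gt0.
Qed.

(** For an outward [v] and the ratio [s] of the pairings of [v] and [v0], the vector [v - s *: v0]
    is killed by the normal, so its determinant with [b] vanishes; and [s] is positive. The factor
    [(-1) ^+ d.+1] is the determinant of the ambient basis. *)
Lemma facet_boundary_orientation (b : seq 'rV[R]_d.+1) v0 (eps : int) :
    size b = d -> {in b, forall u, pairing (a r0) u = 0} ->
    0 < pairing (a r0) v0 -> eps ^+ 2 = 1 ->
    rows_det (v0 :: b) = eps%:~R * (-1) ^+ d.+1 ->
  boundary_orientation polyhedron (forcey_loday_basis R d.+1) facet b eps.
Proof.
move=> sz_b ker_b v0_gt0 eps2 det_v0.
have eps0 : eps != 0 by apply: contra_eq_neq eps2 => ->; rewrite expr0n.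
have free_vb : free (v0 :: b).
  by rewrite free_rows /= ?sz_b // det_v0 mulf_neq0 ?signr_eq0 // intr_eq0.
have free_b : free b by move: free_vb; rewrite free_cons => /andP[].
have ker_det u : pairing (a r0) u = 0 -> rows_det (u :: b) = 0.
  move=> ker_u; apply: rows_det_kernel (a_neq0 valid_r0) _ _; first by rewrite /= sz_b.
  by move=> w; rewrite inE => /predU1P[->|/ker_b].
(* A vector of the kernel outside the span would extend [b] to [d.+1] free vectors with determinant
   0. *)
have ker_span u : pairing (a r0) u = 0 -> u \in <<b>>%VS.
  move=> /ker_det det0; apply: contraT => u_b.
  have : free (u :: b) by rewrite free_cons u_b.
  by rewrite free_rows /= ?sz_b // det0 eqxx.
split; [split=> // [|U] | |].
- by exists p; exact: facet_point.
- split=> [subU | /subvP spanU q q' [_ /= eq_q] [_ /= eq_q']]; last first.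
    by apply/spanU/ker_span; rewrite pairingB eq_q eq_q' subrr.
  (* The other constraints are strict at [p], so a small step along a vector of the kernel stays in
     the facet. *)
  apply/span_subvP => u b_u; have [e e_gt0 sub] := facet_line u.
  have te : `|e / 2| < e by rewrite ger0_norm ?divr_ge0 // ?ltW //; lra.
  have tight : pairing (a r0) (p + (e / 2) *: u) = c r0.
    by rewrite pairingD pairingZ (ker_b u) // mulr0 p_tight addr0.
  have Fu : facet (p + (e / 2) *: u).
    split=> // r vr; have [->|r_r0] := eqVneq r r0; first by rewrite tight.
    exact/ltW/sub.
  have := subU _ _ Fu facet_point; rewrite addrC addKr rpredZeq.
  by rewrite gt_eqF ?divr_gt0.
- by exists p, v0; split; [exact: facet_point | exact: facet_outward].
move=> q v Fq /(outward_facet Fq) v_gt0.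
rewrite /orientation_sign det_mulmx det_inv -!/(rows_mx _) -!/(rows_det _)
  det_forcey_loday_basis.
pose s := pairing (a r0) v / pairing (a r0) v0.
have s_gt0 : 0 < s by rewrite divr_gt0.
have -> : v = s *: v0 + (v - s *: v0) by rewrite addrC subrK.
rewrite rows_det_linear (ker_det (v - _)) ?addr0; last first.
  by rewrite pairingB pairingZ divfK ?subrr // gt_eqF.
rewrite det_v0 mulrA mulfK ?signr_eq0 // sgzM gtr0_sgz // mul1r.
move: eps2 => /eqP; rewrite sqrf_eq1 => /orP[]/eqP->; first by rewrite mulr1z sgz1.
by rewrite mulrNz mulr1z sgzN sgz1.
Qed.

End Facet.

End Polyhedron.

Local Close Scope classical_set_scope.

(** * The multiplihedron of unit weight *)

Section UnitWeight.
Variables (R : realType) (N : nat).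
Let n := N.+1.
Let w := unit_weight R n.
Let T := @interval_set N.
Implicit Types (x : 'rV[R]_N) (A B : {set 'I_N}).

Definition seg_set i1 i2 : {set 'I_N} := [set p : 'I_N | (i1 <= p < i1 + i2.-1)%N].
Definition cuts_set (i : seq nat) : {set 'I_N} := [set p : 'I_N | cuts i p.+1].

Lemma ent_unit t : (0 < t <= n)%N -> ent w t = 1.
Proof.
move=> tn; rewrite /ent (nth_map ord0) ?size_enum_ord //; lia.
Qed.

Lemma unit_weight_block t : (0 < t <= n)%N -> ent w t = 1 * (t - t.-1)%:R :> R.
Proof. by move=> tn; rewrite ent_unit // mul1r (_ : t - t.-1 = 1)%N //; lia. Qed.

Let id_lt t : (t < n)%N -> (t < t.+1)%N. Proof. by []. Qed.

Lemma cut_in_id (A' : pred nat) p : cut_in n id A' p = (0 < p < n)%N && A' p.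
Proof.
apply/hasP/idP => [[t] | /andP[pn Ap]].
  by rewrite mem_index_iota => tn /andP[At /eqP <-]; rewrite tn.
by exists p; rewrite ?mem_index_iota // Ap eqxx.
Qed.

Lemma span_id : span_set N n id = finset.setT.
Proof. by apply/setP => p; rewrite !inE /= ltn_ord. Qed.

Lemma cut_set_id (A' : pred nat) : cut_set N n id A' = [set p : 'I_N | A' p.+1].
Proof. by apply/setP => p; rewrite !inE cut_in_id /= ltnS ltn_ord. Qed.

Lemma cut_set_id_pred (A' : pred nat) A : (forall p : 'I_N, A' p.+1 = (p \in A)) ->
  cut_set N n id A' = A.
Proof. by move=> A'A; rewrite cut_set_id; apply/setP => p; rewrite inE A'A. Qed.

Lemma seg_sum_xsum i1 i2 x : (i1 + i2 <= n)%N -> (0 < i2)%N ->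
  seg_sum i1 i2 x = xsum (x 0) (seg_set i1 i2).
Proof.
move=> le_n i2_gt0; rewrite (seg_sumE (m := n)) // (sum_cut_set x id_lt (leqnn n)).
by rewrite (cut_set_id_pred (A := seg_set i1 i2)) // => p; rewrite inE; lia.
Qed.

Lemma seg_bound_low i1 i2 : (i1 + i2 <= n)%N -> (0 < i2)%N ->
  seg_bound w i1 i2 = (low T finset.setT finset.setT (seg_set i1 i2))%:R.
Proof.
move=> le_n i2_gt0; rewrite (seg_bound_inside w le_n).
rewrite (pair_sum_inside id_lt (leqnn n) unit_weight_block) expr1n mul1r span_id.
rewrite (cut_set_id_pred (A := finset.setT)) => [|p]; last by rewrite finset.in_setT.
by rewrite (cut_set_id_pred (A := seg_set i1 i2)) // => p; rewrite inE; lia.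
Qed.

Lemma cut_sum_xsum i x : composition n i -> cut_sum i x = xsum (x 0) (cuts_set i).
Proof.
move=> comp_i; rewrite (cut_sumE (m := n)) // (sum_cut_set x id_lt (leqnn n)).
by rewrite cut_set_id.
Qed.

Lemma cut_bound_up i : composition n i ->
  cut_bound w i = 2 * (up T finset.setT (cuts_set i))%:R.
Proof.
move=> comp_i; rewrite (cut_boundE _ comp_i).
by rewrite (pair_sum_meets id_lt (leqnn n) unit_weight_block) expr1n mul1r span_id
  cut_set_id.
Qed.

Lemma unit_J_bounds x : forcey_loday w x <-> J_bounds T (x 0) finset.setT finset.setT.
Proof.
have := @forcey_loday_factor R N n id 1 x id_lt (leqnn n) w x unit_weight_block
  (fun _ _ => erefl) isT erefl.
by rewrite span_id (cut_set_id_pred (A := finset.setT)) // => p; rewrite finset.in_setT.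
Qed.

Lemma seg_set_interval i1 i2 i3 : (i1 + i2 + i3 = n)%N -> (2 <= i2)%N ->
  exists kl, T kl = seg_set i1 i2.
Proof.
move=> sum_i i2_ge2; have lt1 : (i1 < N.+1)%N by lia.
have lt2 : (i1 + i2.-1 < N.+1)%N by lia.
by exists (Ordinal lt1, Ordinal lt2); apply/setP => p; rewrite !inE.
Qed.

Lemma interval_seg_set kl : T kl != finset.set0 -> exists i1 i2 i3 : nat,
  [/\ (i1 + i2 + i3 = n)%N, (2 <= i2)%N & T kl = seg_set i1 i2].
Proof.
case: kl => k l /set0Pn[p]; rewrite inE /= => kpl.
exists k, (l - k).+1, (N - l)%N; have := ltn_ord l.
split; [lia | lia | apply/setP => q; rewrite !inE /=; lia].
Qed.

Lemma seg_set_neq0 i1 i2 i3 : (i1 + i2 + i3 = n)%N -> (2 <= i2)%N ->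
  seg_set i1 i2 != finset.set0.
Proof.
move=> sum_i i2_ge2; have lt1 : (i1 < N)%N by lia.
by apply/set0Pn; exists (Ordinal lt1); rewrite inE /=; lia.
Qed.

Lemma cuts_set_neq0 i : composition n i -> (2 <= size i)%N ->
  cuts_set i != finset.set0.
Proof.
move=> comp_i s_ge2; have cut1 : cuts i (partial_sum i 1).
  by apply/hasP; exists 1%N; rewrite ?mem_index_iota /= ?eqxx.
have /andP[p_gt0 p_lt] := cuts_range comp_i cut1.
have lt_p : ((partial_sum i 1).-1 < N)%N by lia.
by apply/set0Pn; exists (Ordinal lt_p); rewrite inE /= prednK.
Qed.

Lemma set_cuts_set A : A != finset.set0 ->
  exists i, [/\ composition n i, (2 <= size i)%N & A = cuts_set i].
Proof.
move=> A0; pose A' p := [exists q in A, q.+1 == p].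
have [i comp_i cutsA] := composition_of A' (ltn0Sn N).
have eqA : A = cuts_set i.
  apply/setP => p; rewrite inE cutsA; last by rewrite /= ltnS.
  apply/idP/existsP => [Ap | [q /andP[Aq]]]; first by exists p; rewrite Ap /=.
  by rewrite eqSS => /eqP/val_inj <-.
exists i; split=> //; case/set0Pn: A0 => p; rewrite eqA inE => /hasP[t].
by rewrite mem_index_iota; lia.
Qed.

Lemma interval_singleton (p : 'I_N) : exists kl, T kl = [set p].
Proof.
exists (inord p, inord p.+1); apply/setP => q; rewrite !inE /= !inordK ?ltnS //;
  last exact: ltnW.
by rewrite -val_eqE /=; lia.
Qed.

Lemma interval_setT : exists kl, T kl = finset.setT.
Proof. by exists (ord0, ord_max); apply/setP => q; rewrite !inE /= ltn_ord. Qed.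

End UnitWeight.

Local Open Scope classical_set_scope.
Local Open Scope ring_scope.

Section ForceyLodayPolyhedron.
Variables (R : realType) (d : nat).
Let N := d.+1.
Let n := N.+1.
Let w := unit_weight R n.
Let T := @interval_set N.
Let J := forcey_loday w.
Implicit Types (x : 'rV[R]_N) (A B : {set 'I_N}).

Definition constraint := (bool * {set 'I_N})%type.

(* [(true, A)] is the lower bound on the sum over the interval [A], and
   [(false, A)] the upper bound on the sum over the set [A]. *)
Definition constraint_valid (r : constraint) : bool :=
  (r.2 != finset.set0) && (r.1 ==> [exists kl, T kl == r.2]).

Definition constraint_normal (r : constraint) : 'cV[R]_N :=
  \col_p ((-1) ^+ r.1 * (p \in r.2)%:R).

Definition constraint_level (r : constraint) : R :=
  if r.1 then - (low T finset.setT finset.setT r.2)%:R else 2 * (up T finset.setT r.2)%:R.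

Lemma pairing_constraint r x :
  pairing (constraint_normal r) x = (-1) ^+ r.1 * xsum (x 0) r.2.
Proof.
rewrite /pairing mxE /xsum mulr_sumr [RHS]big_mkcond; apply: eq_bigr => p _.
by rewrite mxE; case: (_ \in _); rewrite ?mulr1 ?mulr0 // mulrC.
Qed.

Lemma constraint_neq0 r : constraint_valid r -> constraint_normal r != 0.
Proof.
case/andP=> /set0Pn[p rp] _; apply/eqP => /colP/(_ p); rewrite !mxE rp mulr1.
by move/eqP; rewrite signr_eq0.
Qed.

(** Lower bounds hold on all sets by [unit_J_bounds], but are listed for intervals only, so that in
    [forcey_loday_frontier] every tight constraint names a facet. *)
Lemma forcey_loday_polyhedron :
  J = polyhedron constraint_valid constraint_normal constraint_level.
Proof.
apply/seteqP; split => x /=.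
  move/unit_J_bounds => bnd [b A] /=;
    rewrite pairing_constraint /constraint_level /= => _.
  have /andP[lo hi] := bnd A (finset.subsetT A).
  by case: b; rewrite /= ?expr1 ?expr0 ?mulN1r ?mul1r ?lerN2.
move=> bnd; split=> [i1 i2 i3 sum_i i2_ge2 | s i s_ge2 comp_i].
  rewrite seg_bound_low ?seg_sum_xsum //; try lia.
  have [kl Tkl] := seg_set_interval sum_i i2_ge2.
  have := bnd (true, seg_set N i1 i2);
    rewrite pairing_constraint /constraint_level /= expr1 mulN1r lerN2.
  apply; rewrite /constraint_valid /= (seg_set_neq0 sum_i) //=.
  by apply/existsP; exists kl; apply/eqP.
rewrite cut_bound_up // cut_sum_xsum //.
have := bnd (false, cuts_set N i); rewrite pairing_constraint /constraint_level /= mul1r.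
by apply; rewrite /constraint_valid /= cuts_set_neq0 // size_tuple.
Qed.

Lemma forcey_loday_tangent : tangent_basis J (forcey_loday_basis R N).
Proof.
rewrite forcey_loday_polyhedron.
have [x0 bnd] := @interior_point _ _ T R (@interval_singleton N).
apply: (@polyhedron_tangent _ _ _ _ _ _ (\row_p x0 p)) => -[b A] /andP[/= A0 _].
have -> : pairing (constraint_normal (b, A)) (\row_p x0 p) = (-1) ^+ b * xsum x0 A.
  by rewrite pairing_constraint; congr (_ * _); apply: eq_bigr => p _; rewrite mxE.
have /andP[lo hi] := bnd A A0.
by case: b; rewrite /constraint_level /= ?expr1 ?expr0 ?mulN1r ?mul1r ?ltrN2.
Qed.

Lemma forcey_loday_frontier :
  frontier J =
  [set x | (exists i1 i2 i3 : nat,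
              [/\ (i1 + i2 + i3 = n)%N, (2 <= i2)%N & seg_facet w i1 i2 x]) \/
           (exists s (i : s.-tuple nat),
              [/\ (2 <= s)%N, composition n i & cut_facet w i x])].
Proof.
rewrite forcey_loday_polyhedron polyhedron_frontier; last exact: constraint_neq0.
rewrite -forcey_loday_polyhedron.
apply/seteqP; split => x /=.
  move=> [Jx [[[] A] /andP[/= A0]]]; rewrite pairing_constraint /constraint_level /=.
    move=> /existsP[kl /eqP Tkl]; rewrite expr1 mulN1r => /oppr_inj eq_A.
    have [|i1 [i2 [i3 [sum_i i2_ge2 eqT]]]] := @interval_seg_set N kl;
      first by rewrite -/T Tkl.
    left; exists i1, i2, i3; split=> //; split=> //=.
    rewrite seg_sum_xsum ?seg_bound_low -?eqT -/T ?Tkl //; lia.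
  move=> _; rewrite mul1r => eq_A.
  have [i [comp_i s_ge2 defA]] := set_cuts_set A0.
  right; exists (size i), (in_tuple i); split=> //; split=> //=.
  by rewrite cut_sum_xsum // cut_bound_up // -defA.
case=> [[i1 [i2 [i3 [sum_i i2_ge2 [Jx /= eq_x]]]]] | [s [i [s_ge2 comp_i [Jx /= eq_x]]]]].
  split=> //; exists (true, seg_set N i1 i2).
    rewrite /constraint_valid /= (seg_set_neq0 sum_i) //=.
    have [kl Tkl] := seg_set_interval sum_i i2_ge2.
    by apply/existsP; exists kl; apply/eqP.
  rewrite pairing_constraint /constraint_level /= expr1 mulN1r; congr (- _).
  rewrite -seg_sum_xsum ?eq_x ?seg_bound_low //; lia.
split=> //; exists (false, cuts_set N i).
  by rewrite /constraint_valid /= cuts_set_neq0 // size_tuple.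
by rewrite pairing_constraint /constraint_level /= mul1r -cut_sum_xsum // eq_x
  cut_bound_up.
Qed.

Lemma seg_facetE i1 i2 i3 : (i1 + i2 + i3 = n)%N -> (2 <= i2)%N ->
  seg_facet w i1 i2 = facet constraint_valid constraint_normal constraint_level (true,
    seg_set N i1 i2).
Proof.
move=> sum_i i2_ge2; rewrite /seg_facet -/J forcey_loday_polyhedron; congr (_ `&` _).
have le_n : (i1 + i2 <= n)%N by lia.
have i2_gt0 : (0 < i2)%N by lia.
apply/seteqP; split => x /=;
  rewrite pairing_constraint /constraint_level /= expr1 mulN1r seg_sum_xsum //
    seg_bound_low //.
  by move=> ->.
by move/oppr_inj.
Qed.

Lemma cut_facetE i : composition n i ->
  cut_facet w i = facet constraint_valid constraint_normal constraint_level (false,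
    cuts_set N i).
Proof.
move=> comp_i; rewrite /cut_facet -/J forcey_loday_polyhedron; congr (_ `&` _).
by apply/seteqP; split => x /=;
  rewrite cut_sum_xsum ?cut_bound_up // pairing_constraint /constraint_level /= mul1r.
Qed.

Lemma seg_facet_orientation i1 i2 i3 (b : seq 'rV[R]_N) (v0 : 'rV[R]_N) (eps : int) :
    (i1 + i2 + i3 = n)%N -> (2 <= i2)%N -> size b = d ->
    {in b, forall u : 'rV[R]_N, xsum (u 0) (seg_set N i1 i2) = 0} ->
    xsum (v0 0) (seg_set N i1 i2) < 0 -> eps ^+ 2 = 1 ->
    rows_det (v0 :: b) = eps%:~R * (-1) ^+ N ->
  boundary_orientation J (forcey_loday_basis R N) (seg_facet w i1 i2) b eps.
Proof.
move=> sum_i i2_ge2 sz_b ker_b v0_lt0 eps2 det_v0;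
  set S := seg_set N i1 i2 in ker_b v0_lt0.
have [kl Tkl] := seg_set_interval sum_i i2_ge2; have S0 := seg_set_neq0 sum_i i2_ge2.
have vS : constraint_valid (true, S) by rewrite /constraint_valid /= S0 /=;
  apply/existsP; exists kl; apply/eqP.
have [x0 [x0S lo hi]] := @seg_facet_point _ _ T R (@interval_singleton N) S kl Tkl S0.
have x0E r : pairing (constraint_normal r) (\row_p x0 p) = (-1) ^+ r.1 * xsum x0 r.2.
  by rewrite pairing_constraint; congr (_ * _); apply: eq_bigr => p _; rewrite mxE.
rewrite (seg_facetE sum_i) // forcey_loday_polyhedron.
apply: (facet_boundary_orientation constraint_neq0 vS (p := \row_p x0 p) _ _ sz_b _ (v0
  := v0)) => //.
- by rewrite x0E /constraint_level /= x0S expr1 mulN1r.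
- move=> [b' A] /andP[/andP[/= A0 _]]; rewrite x0E /constraint_level /=.
  case: b' => [AS|_]; last by rewrite mul1r hi.
  by rewrite expr1 mulN1r ltrN2 lo //; apply: contraNneq AS => ->.
- by move=> u bu; rewrite pairing_constraint /= ker_b ?mulr0.
by rewrite pairing_constraint /= expr1 mulN1r oppr_gt0.
Qed.

Lemma cut_facet_orientation i (b : seq 'rV[R]_N) (v0 : 'rV[R]_N) (eps : int) :
    composition n i -> (2 <= size i)%N -> size b = d ->
    {in b, forall u : 'rV[R]_N, xsum (u 0) (cuts_set N i) = 0} ->
    0 < xsum (v0 0) (cuts_set N i) -> eps ^+ 2 = 1 ->
    rows_det (v0 :: b) = eps%:~R * (-1) ^+ N ->
  boundary_orientation J (forcey_loday_basis R N) (cut_facet w i) b eps.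
Proof.
move=> comp_i s_ge2 sz_b ker_b v0_gt0 eps2 det_v0; set S := cuts_set N i in ker_b v0_gt0.
have S0 : S != finset.set0 by apply: cuts_set_neq0.
have vS : constraint_valid (false, S) by rewrite /constraint_valid /= S0.
have [kl Tkl] := interval_setT N.
have [x0 [x0S lo hi]] := @cut_facet_point _ _ T R (@interval_singleton N) S kl Tkl S0.
have x0E r : pairing (constraint_normal r) (\row_p x0 p) = (-1) ^+ r.1 * xsum x0 r.2.
  by rewrite pairing_constraint; congr (_ * _); apply: eq_bigr => p _; rewrite mxE.
rewrite (cut_facetE comp_i) // forcey_loday_polyhedron.
apply: (facet_boundary_orientation constraint_neq0 vS (p := \row_p x0 p) _ _ sz_b _ (v0
  := v0)) => //.
- by rewrite x0E /constraint_level /= x0S mul1r.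
- move=> [b' A] /andP[/andP[/= A0 _]]; rewrite x0E /constraint_level /=.
  case: b' => [_|AS]; first by rewrite expr1 mulN1r ltrN2 lo.
  by rewrite mul1r hi //; apply: contraNneq AS => ->.
- by move=> u bu; rewrite pairing_constraint /= ker_b ?mulr0.
by rewrite pairing_constraint /= mul1r.
Qed.

End ForceyLodayPolyhedron.

Local Close Scope classical_set_scope.

(** * Facets and products *)

Section Entries.
Variable R : realType.

Lemma ent_vec N (s : seq R) k : (0 < k <= N)%N -> ent (coords (vec N s)) k = nth 0 s k.-1.
Proof.
move=> kN; have lt_k : (k.-1 < N)%N by lia.
by rewrite /ent -[k.-1]/(nat_of_ord (Ordinal lt_k)) nth_coords mxE.
Qed.

Lemma ent_ord N (x : 'rV[R]_N) (p : 'I_N) : ent (coords x) p.+1 = x 0 p.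
Proof. exact: nth_coords. Qed.

Lemma row_ext N (x y : 'rV[R]_N) :
  (forall k, (0 < k <= N)%N -> ent (coords x) k = ent (coords y) k) -> x = y.
Proof.
by move=> eq_xy; apply/rowP => p; rewrite -!ent_ord eq_xy //= ltn_ord.
Qed.

Lemma ent_fvec N j k : (0 < k <= N)%N -> ent (coords (fvec R N j)) k = - (k == j.+1)%:R.
Proof.
move=> kN; have lt_k : (k.-1 < N)%N by lia.
rewrite -[k in LHS](prednK (n := k)) ?(ent_ord _ (Ordinal lt_k)) ?mxE /=; last lia.
by congr (- _%:R); congr nat_of_bool; lia.
Qed.

Lemma ent0 N k : ent (coords (0 : 'rV[R]_N)) k = 0.
Proof.
have [lt_k|le_k] := ltnP k.-1 N; last by rewrite /ent nth_default ?size_coords.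
by rewrite /ent -[k.-1]/(nat_of_ord (Ordinal lt_k)) nth_coords mxE.
Qed.

Lemma entB N (x y : 'rV[R]_N) k :
  ent (coords (x - y)) k = ent (coords x) k - ent (coords y) k.
Proof.
have [lt_k|le_k] := ltnP k.-1 N; last by rewrite /ent !nth_default ?size_coords ?subr0.
by rewrite /ent -[k.-1]/(nat_of_ord (Ordinal lt_k)) !nth_coords !mxE.
Qed.

Lemma xsum_fvec N j (A : {set 'I_N}) :
  xsum (fvec R N j 0) A = - [exists p in A, p == j :> nat]%:R.
Proof.
rewrite /xsum; have [/existsP[p /andP[Ap /eqP pj]]|no_p] := boolP [exists p in A,
  p == j :> nat].
  rewrite (bigD1 p) //= mxE pj eqxx big1 ?addr0 // => q /andP[_ qp].
  rewrite mxE; case: eqP => [jq|_]; last by rewrite oppr0.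
  by case/eqP: qp; apply: val_inj; rewrite /= pj jq.
rewrite big1 ?oppr0 // => q Aq; rewrite mxE; case: eqP => [jq|_]; last by rewrite oppr0.
by case/existsP: no_p; exists q; rewrite Aq jq /=.
Qed.

Lemma xsumB N (x y : 'rV[R]_N) (A : {set 'I_N}) :
  xsum ((x - y) 0) A = xsum (x 0) A - xsum (y 0) A.
Proof. by rewrite /xsum -sumrB; apply: eq_bigr => p _; rewrite !mxE. Qed.

Definition loday_row N j : 'rV[R]_N :=
  \row_(k < N) ((k == 0 :> nat)%:R - (k == j :> nat)%:R).

Lemma ent_loday N j k : (0 < k <= N)%N ->
  ent (coords (loday_row N j)) k = (k == 1)%:R - (k == j.+1)%:R.
Proof.
move=> kN; have lt_k : (k.-1 < N)%N by lia.
rewrite -[k in LHS](prednK (n := k)) ?(ent_ord _ (Ordinal lt_k)) ?mxE /=; last lia.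
by congr (_%:R - _%:R); congr nat_of_bool; lia.
Qed.

End Entries.

Section SegFacet.
Variables (R : realType) (N i1 i2 i3 : nat).
Let n := N.+1.
Hypotheses (sum_i : (i1 + i2 + i3 = n)%N) (i2_ge2 : (2 <= i2)%N).
Let w := unit_weight R n.
Let theta := @seg_theta R n i1 i2 i3.
Let m := (i1 + 1 + i3)%N.

(** The coordinates of the factor [J] jump over the [i2 - 1] coordinates of the factor [K]; the
    block containing the jump has length [i2], the merged weight of [seg_outer]. *)
Definition outer_pos t := if (t <= i1)%N then t else (t + i2.-1)%N.
Definition inner_pos t := (i1 + t)%N.

Lemma outer_posP t :
  (t <= i1)%N && (outer_pos t == t) || (i1 < t)%N && (outer_pos t == t + i2.-1)%N.
Proof. by rewrite /outer_pos; case: leqP; rewrite eqxx. Qed.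

Lemma seg_theta_outer p t : (0 < t < m)%N ->
  ent (coords (theta p)) (outer_pos t) = ent (coords p.1) t.
Proof.
rewrite /m => tm; have szc := size_coords p.1; have szc2 := size_coords p.2.
have le_i1 : (i1 <= size (coords p.1))%N by rewrite szc; lia.
rewrite ent_vec; last by rewrite /outer_pos; case: ifP; lia.
rewrite !nth_cat size_takel // /outer_pos /ent; case: (leqP t i1) => ti.
  by rewrite ifT ?nth_take //; lia.
rewrite ifF; last lia.
rewrite szc2 ifF; last lia.
by rewrite nth_drop; congr nth; lia.
Qed.

Lemma seg_theta_inner p t : (0 < t < i2)%N ->
  ent (coords (theta p)) (inner_pos t) = ent (coords p.2) t.
Proof.
move=> tm; have szc := size_coords p.1; have szc2 := size_coords p.2.
have le_i1 : (i1 <= size (coords p.1))%N by rewrite szc; lia.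
rewrite ent_vec; last by rewrite /inner_pos; lia.
rewrite !nth_cat size_takel // /inner_pos /ent ifF; last lia.
by rewrite szc2 ifT; [congr nth; lia | lia].
Qed.

Lemma seg_pos_cover k : (0 < k <= N)%N ->
  (exists2 t, (0 < t < m)%N & k = outer_pos t) \/ (exists2 t,
    (0 < t < i2)%N & k = inner_pos t).
Proof.
rewrite /m /outer_pos /inner_pos => kN; have [ki|ik] := leqP k i1.
  by left; exists k; rewrite ?ki //; lia.
have [kj|jk] := ltnP k (i1 + i2).
  by right; exists (k - i1)%N; lia.
by left; exists (k - i2.-1)%N; [lia | case: (leqP _ i1); lia].
Qed.

Lemma seg_theta_inj : injective theta.
Proof.
move=> [p1 p2] [q1 q2] eq_pq; congr (_, _); apply: row_ext => k kN.
  rewrite -(seg_theta_outer (p1, p2)) ?eq_pq ?seg_theta_outer //; move: kN; rewrite /m;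
    lia.
rewrite -(seg_theta_inner (p1, p2)) ?eq_pq ?seg_theta_inner //; move: kN; lia.
Qed.

Lemma seg_theta_surj x : exists p, theta p = x.
Proof.
exists (\row_(j < m.-1) ent (coords x) (outer_pos j.+1),
        \row_(j < i2.-1) ent (coords x) (inner_pos j.+1)).
apply: row_ext => k /seg_pos_cover[] [t tm ->].
  rewrite seg_theta_outer //; have lt_t : (t.-1 < m.-1)%N by lia.
  rewrite -[t](prednK (n := t)) ?(ent_ord _ (Ordinal lt_t)) ?mxE //=; lia.
rewrite seg_theta_inner //; have lt_t : (t.-1 < i2.-1)%N by lia.
rewrite -[t](prednK (n := t)) ?(ent_ord _ (Ordinal lt_t)) ?mxE //=; lia.
Qed.

Let outer_lt t : (t < m)%N -> (outer_pos t < outer_pos t.+1)%N.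
Proof. by move=> _; have := outer_posP t; have := outer_posP t.+1; lia. Qed.

Let outer_le : (outer_pos m <= n)%N.
Proof. by have := outer_posP m; rewrite /m; lia. Qed.

Let inner_lt t : (t < i2)%N -> (inner_pos t < inner_pos t.+1)%N.
Proof. by rewrite /inner_pos; lia. Qed.

Let inner_le : (inner_pos i2 <= n)%N.
Proof. rewrite /inner_pos; lia. Qed.

Lemma nth_unit j : (j < n)%N -> nth 0 (unit_weight R n) j = 1.
Proof. by move=> jn; rewrite (nth_map ord0) ?size_enum_ord. Qed.

Lemma seg_outer_block t : (0 < t <= m)%N ->
  ent (seg_outer w i1 i2 i3) t = 1 * (outer_pos t - outer_pos t.-1)%:R.
Proof.
rewrite mul1r /m => tm; have lt_t : (t.-1 < i1 + 1 + i3)%N by lia.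
rewrite /ent (nth_map (Ordinal lt_t)) ?size_enum_ord // (nth_ord_enum _ (Ordinal lt_t))
  /=.
have szw : size w = n by rewrite size_tuple.
rewrite nth_cat size_takel ?szw; last lia.
have [ti|it] := ltnP t.-1 i1.
  rewrite nth_take // nth_unit; last lia.
  by rewrite (_ : _ - _ = 1)%N //; have := outer_posP t; have := outer_posP t.-1; lia.
have [eq_t|neq_t] := eqVneq t i1.+1.
  rewrite (_ : t.-1 - i1 = 0)%N /=; last lia.
  rewrite (eq_big_nat _ _ (F2 := fun=> 1)) => [|a a2]; last by rewrite ent_unit //; lia.
  rewrite big_const_nat iter_addr_0 subSS subn0; congr _%:R.
  by have := outer_posP t; have := outer_posP t.-1; lia.
rewrite (_ : t.-1 - i1 = (t.-1 - i1).-1.+1)%N /=; last lia.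
rewrite nth_drop nth_unit; last lia.
by rewrite (_ : _ - _ = 1)%N //; have := outer_posP t; have := outer_posP t.-1; lia.
Qed.

Lemma seg_inner_block t : (0 < t <= i2)%N ->
  ent (seg_inner w i1 i2) t = 1 * (inner_pos t - inner_pos t.-1)%:R.
Proof.
rewrite mul1r => tm; have lt_t : (t.-1 < i2)%N by lia.
rewrite /ent (nth_map (Ordinal lt_t)) ?size_enum_ord // (nth_ord_enum _ (Ordinal lt_t))
  /=.
rewrite nth_take // nth_drop nth_unit; last lia.
by rewrite /inner_pos (_ : _ - _ = 1)%N //; lia.
Qed.

Lemma outer_cut_set : cut_set N m outer_pos predT = ~: seg_set N i1 i2.
Proof.
apply/setP => p; rewrite !inE; apply/hasP/idP => [[t] | p_out].
  rewrite mem_index_iota /m => tm /= /eqP; have := outer_posP t.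
  by have := ltn_ord p; lia.
have lt_p := ltn_ord p; have := seg_pos_cover (k := p.+1).
case=> [|[t tm eq_t]|[t tm eq_t]]; first by lia.
  by exists t; rewrite ?mem_index_iota // -eq_t /=.
by case/negP: p_out; move: eq_t; rewrite /inner_pos; lia.
Qed.

Lemma outer_span_set : span_set N m outer_pos = finset.setT.
Proof.
apply/setP => p; rewrite !inE; have := ltn_ord p.
by have := outer_posP 0; have := outer_posP m; rewrite /m; lia.
Qed.

Lemma inner_cut_set : cut_set N i2 inner_pos predT = seg_set N i1 i2.
Proof.
apply/setP => p; rewrite !inE; apply/hasP/idP => [[t] | p_in].
  by rewrite mem_index_iota /inner_pos => tm /= /eqP; lia.
by exists (p.+1 - i1)%N; rewrite ?mem_index_iota /inner_pos /=; lia.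
Qed.

Lemma inner_span_set : span_set N i2 inner_pos = seg_set N i1 i2.
Proof. by apply/setP => p; rewrite !inE /inner_pos; lia. Qed.

Lemma seg_theta_facet p : seg_product w i1 i2 i3 p <-> seg_facet w i1 i2 (theta p).
Proof.
have m_gt0 : (0 < m)%N by rewrite /m; lia.
have outer := forcey_loday_factor outer_lt outer_le seg_outer_block
  (fun t tm => esym (seg_theta_outer p tm)) m_gt0 erefl.
have inner := loday_factor inner_lt inner_le seg_inner_block
  (fun t tm => esym (seg_theta_inner p tm)).
rewrite outer_span_set outer_cut_set in outer.
rewrite inner_span_set inner_cut_set expr1n in inner.
have facetE := @seg_facet_bounds _ _ (@interval_set N) R (theta p 0) (seg_set N i1 i2).
have boundsJ := unit_J_bounds (theta p).
rewrite /seg_facet /seg_product /=.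
split=> [[/outer bndO /inner bndI] | [/boundsJ bnd /= eq_x]].
  have [bnd eq_x] := facetE.2 (conj bndO bndI); split; first exact/boundsJ.
  by rewrite /= seg_sum_xsum ?seg_bound_low ?eq_x //; lia.
rewrite seg_sum_xsum ?seg_bound_low in eq_x; try lia.
by have [bndO bndI] := facetE.1 (conj bnd eq_x); split; [apply/outer | apply/inner].
Qed.

Lemma seg_theta_bij :
  set_bij (seg_product w i1 i2 i3) (seg_facet w i1 i2) theta.
Proof.
split.
- by move=> p /seg_theta_facet.
- by move=> p q _ _; apply: seg_theta_inj.
move=> x Fx; have [p eq_p] := seg_theta_surj x.
by exists p; rewrite // seg_theta_facet eq_p.
Qed.

Lemma seg_theta_fvec j : (j < m.-1)%N ->
  theta (fvec R m.-1 j, 0) = fvec R N (outer_pos j.+1).-1.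
Proof.
move=> jm; have pos_gt0 : (0 < outer_pos j.+1)%N by have := outer_posP j.+1; lia.
apply: row_ext => k kN; rewrite ent_fvec // prednK //.
case: (seg_pos_cover kN) => -[t tm ->].
  rewrite seg_theta_outer // ent_fvec; last by lia.
  congr (- _%:R); congr nat_of_bool.
  by have := outer_posP t; have := outer_posP j.+1; lia.
rewrite seg_theta_inner // ent0 (_ : _ == _ = false) ?oppr0 //.
by have := outer_posP j.+1; rewrite /inner_pos; lia.
Qed.

(** This is [e_j = f_(j+1) - f_1], with positions moved by [i1]. *)
Lemma seg_theta_loday j : (0 < j < i2.-1)%N ->
  theta (0, loday_row R i2.-1 j) = fvec R N (i1 + j) - fvec R N i1.
Proof.
move=> ji; apply: row_ext => k kN; rewrite entB !ent_fvec //.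
case: (seg_pos_cover kN) => -[t tm ->].
  have out s : (i1 <= s < i1 + i2.-1)%N -> (outer_pos t == s.+1) = false.
    by have := outer_posP t; move: tm; rewrite /m; lia.
  by rewrite seg_theta_outer // ent0 !out ?subrr //; lia.
rewrite seg_theta_inner // ent_loday; last by lia.
rewrite opprK [RHS]addrC; congr (_%:R - _%:R); congr nat_of_bool; rewrite /inner_pos.
  lia.
lia.
Qed.

Lemma seg_basisE : seg_basis R n i1 i2 i3 =
  [seq fvec R N k | k <- iota 0 i1 ++ iota (i1 + i2.-1) i3] ++
  [seq fvec R N k - fvec R N i1 | k <- iota i1.+1 i2.-2].
Proof.
rewrite /seg_basis; congr (_ ++ _).
  rewrite forcey_loday_basisE -map_comp.
  have -> : iota 0 i1 ++ iota (i1 + i2.-1) i3 =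
      [seq (outer_pos j.+1).-1 | j <- iota 0 (i1 + 1 + i3).-1].
    apply: (@eq_from_nth _ 0%N) => [|j].
      by rewrite size_cat size_map !size_iota /m; lia.
    rewrite size_cat !size_iota => lt_j.
    rewrite (nth_map 0%N) ?size_iota ?nth_iota /m; try lia.
    rewrite nth_cat size_iota add0n; have := outer_posP j.+1.
    by case: ltnP => ji; rewrite nth_iota; lia.
  rewrite -[RHS]map_comp; apply/eq_in_map => j; rewrite mem_iota /= => jm.
  exact: seg_theta_fvec.
rewrite /loday_basis -map_comp -[i1.+1]addn1 iotaDl -[RHS]map_comp.
by apply/eq_in_map => j; rewrite mem_iota => ji /=; apply: seg_theta_loday; lia.
Qed.

End SegFacet.

(** Lowering the first coordinate of the Loday factor violates the lower bound, so [fvec i1] points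
    outwards. In front of the basis it also clears the term subtracted in each image of [e_j], and
    [rows_det_seg] applies. *)
Lemma seg_basis_orientation (R : realType) d i1 i2 i3 :
    (i1 + i2 + i3 = d.+2)%N -> (2 <= i2)%N ->
  boundary_orientation (forcey_loday (unit_weight R d.+2)) (forcey_loday_basis R d.+1)
    (seg_facet (unit_weight R d.+2) i1 i2) (seg_basis R d.+2 i1 i2 i3)
    ((-1) ^+ (i1 + i2 * i3)).
Proof.
move=> sum_i i2_ge2; have basisE := seg_basisE R sum_i i2_ge2.
have xsum_in k : (i1 <= k < i1 + i2.-1)%N -> xsum (fvec R d.+1 k 0) (seg_set d.+1 i1
  i2) = -1.
  move=> ki; rewrite xsum_fvec (_ : [exists p in _, _] = true) //.
  have lt_k : (k < d.+1)%N by lia.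
  by apply/existsP; exists (Ordinal lt_k); rewrite inE /= ki eqxx.
have xsum_out k : ~~ (i1 <= k < i1 + i2.-1)%N -> xsum (fvec R d.+1 k 0) (seg_set d.+1
  i1 i2) = 0.
  move=> ki; rewrite xsum_fvec (_ : [exists p in _, _] = false) ?oppr0 //.
  by apply/existsP => -[p]; rewrite inE => /andP[pi /eqP pk]; rewrite -pk pi in ki.
apply: (seg_facet_orientation (v0 := fvec R d.+1 i1) sum_i i2_ge2).
- by rewrite basisE size_cat !size_map size_cat !size_iota; lia.
- move=> u; rewrite basisE mem_cat => /orP[]/mapP[k].
    by rewrite mem_cat !mem_iota => k_in ->; apply: xsum_out; lia.
  by rewrite mem_iota => k_in ->; rewrite xsumB !xsum_in ?subrr //; lia.
- by rewrite xsum_in ?oppr_lt0 ?ltr01 //; lia.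
- by rewrite sqrr_sign.
rewrite rmorphXn rmorphN1 -(rows_det_seg R sum_i i2_ge2) map_cons basisE.
pose k0 := (i1 + i3)%N.
apply: (rows_det_add (c := fun a => if (a < k0)%N then 0 else -1)) => a a_d.
rewrite /= catA [in RHS]map_cat !nth_cat !size_map !size_cat !size_iota -/k0.
case: ltnP => ak; first by rewrite scale0r addr0.
have lt_a : (a - k0 < i2.-2)%N by rewrite /k0 in ak *; lia.
by rewrite !(nth_map 0%N) ?size_iota // scaleN1r.
Qed.

Section CutFacet.
Variables (R : realType) (N s : nat) (i : s.-tuple nat).
Let n := N.+1.
Hypotheses (comp_i : composition n i) (s_ge2 : (2 <= s)%N).
Let w := unit_weight R n.
Let theta := @cut_theta R n s i.
Let P := partial_sum i.
Implicit Types (t u : 'I_s).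

Let size_i : size i = s. Proof. exact: size_tuple. Qed.

Lemma cut_pos_lt r : (r < s)%N -> (P r < P r.+1)%N.
Proof. by rewrite -size_i; apply: partial_sum_lt comp_i r. Qed.

Lemma cut_pos0 : P 0 = 0%N. Proof. by rewrite /P /partial_sum take0. Qed.

Lemma cut_pos_last : P s = n.
Proof. by rewrite -size_i /P (partial_sum_size comp_i). Qed.

Lemma cut_posS t : P t.+1 = (P t + tnth i t)%N.
Proof. by rewrite /P partial_sumS ?size_i // (tnth_nth 0%N). Qed.

Lemma part_gt0 t : (0 < tnth i t)%N.
Proof. by case/andP: comp_i => _ /allP; apply; apply: mem_tnth. Qed.

Lemma cut_pos_mono a b : (a <= b <= s)%N -> (P a <= P b)%N.
Proof. by move=> ab; rewrite leqNgt (increasing_lt_iff cut_pos_lt); lia. Qed.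

(** Coordinates are written [P t + j]: for [j = 0] this is the cut that opens the block [t], absent
    when [t = 0], and for [j > 0] the entry [j] of that block. *)
Lemma cut_pos_cover k : (k <= N)%N -> exists t j, [/\ (j < tnth i t)%N & k = (P t + j)%N].
Proof.
move=> kN; have [|t ts] := block_exists (m := s) (P := P) (k := k.+1).
  by rewrite cut_pos0 cut_pos_last.
rewrite /block => blk; have lt_t : (t.-1 < s)%N by lia.
have := cut_posS (Ordinal lt_t); rewrite /= prednK; last lia.
by exists (Ordinal lt_t), (k - P t.-1)%N; split; rewrite /=; lia.
Qed.

Lemma cut_pos_uniq t u j j' : (j < tnth i t)%N -> (j' < tnth i u)%N ->
  (P t + j == P u + j')%N = (t == u) && (j == j').
Proof.
move=> jt ju; have Pt := cut_posS t; have Pu := cut_posS u.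
have [->|tu] := eqVneq t u; first by rewrite eqn_add2l.
rewrite -val_eqE /= in tu; apply/negbTE/eqP => eq_tu.
have [lt_tu|lt_ut] : (t < u)%N \/ (u < t)%N by lia.
  by have := cut_pos_mono (a := t.+1) (b := u); have := ltn_ord u; lia.
by have := cut_pos_mono (a := u.+1) (b := t); have := ltn_ord t; lia.
Qed.

Section Entry.
Variable p : 'rV[R]_s.-1 * (forall t, 'rV[R]_(tnth i t).-1).

(** A dummy 0 in place of the missing [x_0] gives the row [t] exactly the length of the part [t].
    The entry [j] of this row is then at index [P t + j] of the flattened list, and the dummy
    absorbs the shift to coordinates numbered from 1. *)
Let row t : seq R := (if t == 0 :> nat then 0 else ent (coords p.1) t) :: coords (p.2 t).

Let flatten_row : 0 :: flatten [seq (if t == 0 :> nat then [::] else [:: ent (coords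
  p.1) t])
                        ++ coords (p.2 t) | t : 'I_s] = flatten [seq row t | t : 'I_s].
Proof.
rewrite /image_mem; have :
  0%N \in map val (enum 'I_s) by rewrite val_enum_ord mem_iota; lia.
have sorted_s : sorted ltn (map val (enum 'I_s)) by rewrite val_enum_ord iota_ltn_sorted.
case: (enum 'I_s) sorted_s => [//|t0 ts] /= path_ts; rewrite inE => zero_in.
have t00 : t0 = 0%N :> nat.
  move: path_ts zero_in; rewrite path_sortedE; last exact: ltn_trans.
  by case/andP=> /allP lt_t0 _ /predU1P[<-//|/lt_t0].
rewrite /row t00 eqxx /=; congr (_ :: _ ++ flatten _); apply/eq_in_map => t t_in.
have -> // : (t == 0 :> nat) = false.
apply/negbTE; rewrite -lt0n -t00.
have := path_ts; rewrite path_sortedE; last exact: ltn_trans.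
by case/andP=> /allP/(_ t) + _; apply; apply: map_f.
Qed.

Lemma cut_theta_entry t j : (j < tnth i t)%N -> (0 < P t + j)%N ->
  ent (coords (theta p)) (P t + j) =
  nth 0 ((if t == 0 :> nat then 0 else ent (coords p.1) t) :: coords (p.2 t)) j.
Proof.
move=> jt pos_gt0.
have le_N : (P t + j <= N)%N.
  have := cut_posS t; have := cut_pos_mono (a := t.+1) (b := s).
  by rewrite cut_pos_last ltn_ord leqnn => /(_ isT); lia.
rewrite ent_vec ?pos_gt0 //.
have -> (l : seq R) : nth 0 l (P t + j).-1 = nth 0 (0 :: l) (P t + j).
  by rewrite -{2}(prednK pos_gt0).
rewrite flatten_row nth_flatten.
have -> : shape [seq row u | u : 'I_s] = i.
  rewrite /shape -map_comp -[RHS](map_tnth_enum i); apply/eq_map => u /=.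
  by rewrite size_coords prednK ?part_gt0.
have jt' : (j < nth 0%N i t)%N by rewrite -tnth_nth.
rewrite -[(P t + j)%N]/(flatten_index i t j) flatten_indexKl ?flatten_indexKr //.
by rewrite (nth_map t) ?size_enum_ord // nth_ord_enum.
Qed.

End Entry.

Lemma cut_theta_outer p r : (0 < r < s)%N ->
  ent (coords (theta p)) (P r) = ent (coords p.1) r.
Proof.
move=> ts; have lt_t : (r < s)%N by lia.
have := @cut_theta_entry p (Ordinal lt_t) 0 (part_gt0 _).
rewrite addn0 /= => ->; last by rewrite -cut_pos0; apply: (increasing_lt cut_pos_lt); lia.
by rewrite ifF //; lia.
Qed.

Lemma cut_theta_inner p t j : (0 < j < tnth i t)%N ->
  ent (coords (theta p)) (P t + j) = ent (coords (p.2 t)) j.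
Proof.
move=> jt; rewrite cut_theta_entry; try lia.
by case: j jt => // j _.
Qed.

Lemma cut_cover k : (0 < k <= N)%N ->
  (exists2 r, (0 < r < s)%N & k = P r) \/
  (exists t j, (0 < j < tnth i t)%N /\ k = (P t + j)%N).
Proof.
case/andP=> k_gt0 kN; have [t [[|j] [jt eq_k]]] := cut_pos_cover kN; last by right;
  exists t, j.+1.
left; exists t; last by rewrite eq_k addn0.
rewrite ltn_ord andbT lt0n; apply: contraTneq k_gt0 => t0.
by rewrite eq_k t0 cut_pos0.
Qed.

Lemma cut_theta_inj : injective theta.
Proof.
move=> [p1 p2] [q1 q2] eq_pq; congr (_, _).
  apply: row_ext => k ks.
  by rewrite -(cut_theta_outer (p1, p2)) ?eq_pq ?cut_theta_outer //; move: ks; lia.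
apply: functional_extensionality_dep => t; apply: row_ext => j jt.
by rewrite -(cut_theta_inner (p1, p2)) ?eq_pq ?cut_theta_inner //; move: jt; lia.
Qed.

Lemma cut_theta_surj x : exists p, theta p = x.
Proof.
exists (\row_(j < s.-1) ent (coords x) (P j.+1),
        fun t => \row_(j < (tnth i t).-1) ent (coords x) (P t + j.+1)).
apply: row_ext => k /cut_cover[[t tm ->]|[t [j [jt ->]]]].
  rewrite cut_theta_outer //; have lt_t : (t.-1 < s.-1)%N by lia.
  rewrite -[t](prednK (n := t)) ?(ent_ord _ (Ordinal lt_t)) ?mxE //=; lia.
rewrite cut_theta_inner //; have lt_j : (j.-1 < (tnth i t).-1)%N by lia.
rewrite -[j](prednK (n := j)) ?(ent_ord _ (Ordinal lt_j)) ?mxE //=; lia.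
Qed.

Lemma cut_outer_block r : (0 < r <= s)%N ->
  ent (cut_outer w i) r = Num.sqrt 2 * (P r - P r.-1)%:R.
Proof.
move=> ts; have lt_t : (r.-1 < s)%N by lia.
rewrite /ent (nth_map (Ordinal lt_t)) ?size_enum_ord // (nth_ord_enum _ (Ordinal lt_t))
  /=.
congr (_ * _); rewrite prednK; last lia.
have eqP' := cut_posS (Ordinal lt_t); rewrite /= prednK in eqP'; last lia.
have le_n := cut_pos_mono (a := r) (b := s); rewrite cut_pos_last in le_n.
rewrite /Omega -(tnth_nth _ i (Ordinal lt_t)) -/(partial_sum i r.-1) -/P.
rewrite (eq_big_nat _ _ (F2 := fun=> 1)) => [|a a2]; last by rewrite ent_unit //; lia.
by rewrite big_const_nat iter_addr_0 subSS subn0; congr _%:R; lia.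
Qed.

Lemma cut_inner_block t j : (0 < j <= tnth i t)%N ->
  ent (cut_inner w i t) j = 1 * ((P t + j) - (P t + j.-1))%:R.
Proof.
move=> jt; have lt_j : (j.-1 < tnth i t)%N by lia.
rewrite /ent (nth_map (Ordinal lt_j)) ?size_enum_ord // (nth_ord_enum _ (Ordinal lt_j))
  /=.
have := cut_posS t; have := cut_pos_mono (a := t.+1) (b := s).
rewrite cut_pos_last ltn_ord leqnn => /(_ isT) le_n Pt.
rewrite nth_take // nth_drop nth_unit; last by rewrite -/(partial_sum i t) -/P; lia.
by rewrite mul1r (_ : _ - _ = 1)%N //; lia.
Qed.

Lemma cut_set_outer : cut_set N s P predT = cuts_set N i.
Proof. by rewrite /cuts_set /cuts size_i. Qed.

Lemma span_set_outer : span_set N s P = finset.setT.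
Proof. by apply/setP => p; rewrite !inE cut_pos0 cut_pos_last /= ltn_ord. Qed.

(** A block contains the cut that ends it, which is why [B] below removes the cuts. The blocks cover
    all coordinates, so the default is never taken. *)
Definition block_of (p : 'I_N) : 'I_s :=
  odflt (Ordinal (ltnW s_ge2)) [pick t : 'I_s | block P t.+1 p.+1].

Lemma block_ofP (p : 'I_N) t : (block_of p == t) = block P t.+1 p.+1.
Proof.
rewrite /block_of; case: pickP => [u blk_u|no_t] /=.
  apply/eqP/idP => [<-//|blk_t]; apply: val_inj.
  by have /eq_add_S := block_uniq cut_pos_lt (ltn_ord u : 0 < u.+1 <= s)%N (ltn_ord t :
    0 < t.+1 <= s)%N blk_u blk_t.
have [|r ts blk] := block_exists (m := s) (P := P) (k := p.+1).
  by rewrite cut_pos0 cut_pos_last; apply: leqW (ltn_ord p).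
have lt_t : (r.-1 < s)%N by lia.
by have := no_t (Ordinal lt_t); rewrite /= prednK ?blk //; lia.
Qed.

Lemma cuts_setP (p : 'I_N) : p \in cuts_set N i = [exists t : 'I_s,
  (0 < t)%N && (P t == p.+1)].
Proof.
rewrite inE /cuts /cut_in size_i; apply/hasP/existsP => [[t] | [t /andP[t0 Pt]]].
  by rewrite mem_index_iota => /andP[t1 ts] /= Pt; exists (Ordinal ts); rewrite t1 /=.
by exists (nat_of_ord t); rewrite // mem_index_iota t0 /=.
Qed.

Let B u := [set p in ~: cuts_set N i | block_of p == u].

Lemma blockE u : B u = [set p : 'I_N | (P u <= p < (P u + tnth i u).-1)%N].
Proof.
have u_gt0 := part_gt0 u; have Pu := cut_posS u.
apply/setP => p; rewrite inE block_ofP [in RHS]inE finset.in_setC cuts_setP /block /=.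
apply/andP/idP => [[/existsP not_cut] | p_in].
  suff : P u.+1 != p.+1 by lia.
  apply/negP => /eqP Pp; have [lt_u|] := ltnP u.+1 s.
    by apply: not_cut; exists (Ordinal lt_u); rewrite /= Pp.
  rewrite leq_eqVlt ltnS leqNgt ltn_ord orbF => /eqP u_s.
  by have := ltn_ord p; rewrite -u_s cut_pos_last in Pp; lia.
split; last lia.
apply/existsP => -[t /andP[t0 /eqP Pt]].
have := increasing_lt_iff cut_pos_lt (s := u) (t := t).
have := increasing_lt_iff cut_pos_lt (s := t) (t := u.+1).
have := ltn_ord t; have := ltn_ord u; lia.
Qed.

Lemma cut_set_inner u : cut_set N (tnth i u) (addn (P u)) predT = B u.
Proof.
rewrite blockE; apply/setP => p; rewrite !inE; apply/hasP/idP => [[t] | p_in].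
  by rewrite mem_index_iota => tm /= /eqP; lia.
by exists (p.+1 - P u)%N; rewrite ?mem_index_iota /=; lia.
Qed.

Lemma span_set_inner u : span_set N (tnth i u) (addn (P u)) = B u.
Proof. by rewrite blockE /span_set addn0. Qed.

(** If [p <= q] were in different blocks, the cut opening the block of [q] would lie between them,
    hence in the interval. *)
Lemma block_connected kl p q :
    @interval_set N kl :&: cuts_set N i == finset.set0 ->
    p \in @interval_set N kl -> q \in @interval_set N kl -> block_of p = block_of q.
Proof.
wlog le_pq : p q / (p <= q)%N => [wl disj pT qT|].
  by case/orP: (leq_total p q) => le; [apply: wl | symmetry; apply: wl].
move=> /set0_at disj pT qT; apply/eqP; rewrite block_ofP.
have : block P (block_of q).+1 q.+1 by rewrite -block_ofP.
have : block P (block_of p).+1 p.+1 by rewrite -block_ofP.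
move: (block_of p) (block_of q) => t u /andP[/= Pt pt] /andP[/= Pu qu].
apply/andP; split=> /=; last by lia.
rewrite ltnNge; apply/negP => Pu_p.
have u_gt0 : (0 < u)%N by rewrite lt0n; apply: contraTneq Pu_p => ->; rewrite cut_pos0.
have lt_r : ((P u).-1 < N)%N by have := ltn_ord q; lia.
have := disj (Ordinal lt_r); rewrite finset.in_setI cuts_setP => /negP; apply;
  apply/andP; split.
  by move: pT qT; rewrite !inE /=; lia.
by apply/existsP; exists u; rewrite u_gt0 /=; lia.
Qed.

Lemma cut_theta_facet p : cut_product w i p <-> cut_facet w i (theta p).
Proof.
have last_le : (P s <= n)%N by rewrite cut_pos_last.
have outer := loday_factor cut_pos_lt last_le cut_outer_block
  (fun r rs => esym (cut_theta_outer p rs)).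
rewrite span_set_outer cut_set_outer sqr_sqrtr // in outer.
have inner u : forcey_loday (cut_inner w i u) (p.2 u) <->
    J_bounds (@interval_set N) (theta p 0) (B u) (B u).
  have inner_lt r : (r < tnth i u)%N -> (P u + r < P u + r.+1)%N by rewrite addnS.
  have inner_le : (P u + tnth i u <= n)%N.
    have := cut_posS u; have := cut_pos_mono (a := u.+1) (b := s).
    by rewrite cut_pos_last ltn_ord leqnn => /(_ isT); lia.
  have := forcey_loday_factor (P := addn (P u)) inner_lt inner_le (@cut_inner_block u)
    (fun r rt => esym (cut_theta_inner p rt)) (part_gt0 u) erefl.
  by rewrite span_set_inner cut_set_inner.
have facetE := @cut_facet_bounds _ _ (@interval_set N) R (theta p 0) (cuts_set N i)
  'I_s block_of block_connected.
have boundsJ := unit_J_bounds (theta p).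
rewrite /cut_facet /cut_product /=.
split=> [[/outer bndO bndI] | [/boundsJ bnd /= eq_x]].
  have [bnd eq_x] := facetE.2 (conj bndO (fun u => (inner u).1 (bndI u))).
  split; first exact/boundsJ.
  by rewrite /= cut_sum_xsum ?cut_bound_up.
rewrite cut_sum_xsum ?cut_bound_up // in eq_x.
have [bndO bndI] := facetE.1 (conj bnd eq_x); split; first exact/outer.
by move=> u; apply/inner/bndI.
Qed.

Lemma cut_theta_bij : set_bij (cut_product w i) (cut_facet w i) theta.
Proof.
split.
- by move=> p /cut_theta_facet.
- by move=> p q _ _; apply: cut_theta_inj.
move=> x Fx; have [p eq_p] := cut_theta_surj x.
by exists p; rewrite // cut_theta_facet eq_p.
Qed.

End CutFacet.

Lemma cut_positionsE o i : cut_positions o i =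
  [seq (o + partial_sum i j.+1).-1 | j <- iota 0 (size i).-1].
Proof.
elim: i o => [|a [|b i] IH] o //.
rewrite -[LHS]/((o + a).-1 :: cut_positions (o + a) (b :: i)) IH /=.
congr (_ :: _); first by rewrite /partial_sum /= addn0.
rewrite -[1%N]addn0 iotaDl -map_comp; apply/eq_map => j /=.
by rewrite add1n /partial_sum /= !addnA.
Qed.

Lemma block_positionsE o i : block_positions o i =
  flatten [seq iota (o + partial_sum i t) (nth 0%N i t).-1 | t <- iota 0 (size i)].
Proof.
elim: i o => [|a i IH] o //=; rewrite IH; congr (_ ++ flatten _).
  by rewrite /partial_sum take0 addn0.
rewrite -[1%N]addn0 iotaDl -map_comp; apply/eq_map => j /=.
by rewrite add1n /partial_sum /= !addnA.
Qed.

(** The block of [i_u - 1] coordinates crosses [s - u] cuts; the term [u] of [epsB] is the opposite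
    of this number of transpositions. *)
Lemma epsB_unshuffle n i : composition n i -> epsB i = - (unshuffle i)%:Z.
Proof.
case/andP=> _; elim: i => [|a i IH] /=; first by rewrite /epsB big_geq.
case/andP=> a_gt0 /IH eps_i.
rewrite /epsB big_ltn //= PoszD opprD -eps_i /epsB; congr (_ + _).
  have -> : 1 - a%:Z = - a.-1%:Z by lia.
  have -> : (size i).+1%:Z - 1%:Z = size i by lia.
  by rewrite mulrN PoszM.
rewrite big_add1 /= !big_nat; apply: eq_bigr => u /andP[u_gt0 u_i].
by case: u u_gt0 u_i => // u _ _ /=; congr (_ * _); lia.
Qed.

Lemma sign_epsB n i : composition n i -> (-1 : int) ^ epsB i = (-1) ^+ unshuffle i.
Proof.
by move=> /epsB_unshuffle->; rewrite -exprnN exprnP; rewrite -exprVn invrN1.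
Qed.

Lemma size_block_positions o i : all (leq 1) i ->
  (size (block_positions o i) + size i)%N = sumn i.
Proof.
elim: i o => //= a i IH o /andP[a_gt0 /(IH (o + a)%N)].
by rewrite size_cat size_iota; lia.
Qed.

Section CutBasis.
Variables (R : realType) (N s : nat) (i : s.-tuple nat).
Let n := N.+1.
Hypotheses (comp_i : composition n i) (s_ge2 : (2 <= s)%N).
Let theta := @cut_theta R n s i.
Let P := partial_sum i.
Let y0 : forall t : 'I_s, 'rV[R]_(tnth i t).-1 := fun=> 0.

Let P_inj a b : (a <= s)%N -> (b <= s)%N -> (P a == P b) = (a == b).
Proof.
move=> le_a le_b; apply/eqP/eqP => [eq_ab|->//].
have := increasing_lt_iff (cut_pos_lt comp_i) le_a le_b;
  have := increasing_lt_iff (cut_pos_lt comp_i) le_b le_a.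
by rewrite -/P eq_ab ltnn; lia.
Qed.

Let P_gt0 a : (0 < a <= s)%N -> (0 < P a)%N.
Proof. by move=> a_s; apply: leq_ltn_trans (increasing_lt (cut_pos_lt comp_i) a_s). Qed.

Let P_uniq0 a (u : 'I_s) j :
  (a < s)%N -> (0 < j < tnth i u)%N -> (P u + j == P a)%N = false.
Proof.
move=> a_s /andP[j_gt0 j_u]; rewrite -[P a]addn0.
rewrite (cut_pos_uniq comp_i s_ge2 j_u (part_gt0 comp_i (Ordinal a_s))).
by rewrite [j == 0]eqn0Ngt j_gt0 andbF.
Qed.

Lemma cut_theta_loday j : (0 < j < s.-1)%N ->
  theta (loday_row R s.-1 j, y0) = fvec R N (P j.+1).-1 - fvec R N (P 1).-1.
Proof.
move=> js; apply: row_ext => k kN; rewrite entB !ent_fvec // !prednK ?P_gt0 //; try lia.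
case: (cut_cover comp_i s_ge2 kN) => [[t ts ->]|[u [j' [ju ->]]]].
  rewrite cut_theta_outer // ent_loday; last lia.
  rewrite !P_inj; try lia.
  by rewrite opprK addrC.
by rewrite cut_theta_inner // ent0 !P_uniq0 ?subrr //; lia.
Qed.

Lemma cut_theta_fvec (t : 'I_s) j : (j < (tnth i t).-1)%N ->
  theta (0, dfwith y0 t (fvec R _ j)) = fvec R N (P t + j).
Proof.
move=> jt; apply: row_ext => k kN; rewrite ent_fvec //.
case: (cut_cover comp_i s_ge2 kN) => [[r rs ->]|[u [j' [ju ->]]]].
  rewrite cut_theta_outer // ent0 -addnS eq_sym P_uniq0 ?oppr0 //; lia.
rewrite cut_theta_inner //= -addnS (cut_pos_uniq comp_i s_ge2); try lia.
have [ut|ut] := eqVneq u t.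
  by rewrite ut in ju *; rewrite dfwithin ent_fvec //; lia.
by rewrite dfwithout 1?eq_sym // ent0 oppr0.
Qed.

Lemma cut_basisE : cut_basis R n i =
  [seq fvec R N k - fvec R N (P 1).-1 | k <- behead (cut_positions 0 i)] ++
  [seq fvec R N k | k <- block_positions 0 i].
Proof.
rewrite /cut_basis; congr (_ ++ _).
  rewrite cut_positionsE size_tuple -behead_map -map_comp.
  have -> : iota 0 s.-1 = 0%N :: iota 1 s.-2 by case: (s) s_ge2 => [|[]].
  rewrite /loday_basis -map_comp; apply/eq_in_map => j; rewrite mem_iota => js.
  by apply: cut_theta_loday; lia.
rewrite block_positionsE size_tuple map_flatten -map_comp.
rewrite -val_enum_ord; congr flatten; rewrite -[RHS]map_comp; apply/eq_map => t /=.
rewrite -(tnth_nth _ i t) forcey_loday_basisE -map_comp add0n.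
rewrite -[partial_sum i t]addn0 iotaDl -[RHS]map_comp; apply/eq_in_map => j.
by rewrite mem_iota => jt /=; apply: cut_theta_fvec.
Qed.

End CutBasis.

(** Raising the first cut coordinate violates the upper bound, so the outward vector is [- fvec p1],
    whose sign is the one in front of [(-1) ^ epsB i]. The remaining determinant is that of the cut
    positions followed by the blocks. *)
Lemma cut_basis_orientation (R : realType) d s (i : s.-tuple nat) :
    composition d.+2 i -> (2 <= s)%N ->
  boundary_orientation (forcey_loday (unit_weight R d.+2)) (forcey_loday_basis R d.+1)
    (cut_facet (unit_weight R d.+2) i) (cut_basis R d.+2 i) (- (-1) ^ epsB i).
Proof.
move=> comp_i s_ge2; have basisE := cut_basisE R comp_i s_ge2.
have size_i : size i = s := size_tuple i.
set p1 := (partial_sum i 1).-1 in basisE.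
have i_neq0 : val i != [::] by rewrite -size_eq0 size_i; lia.
have cuts_cons : cut_positions 0 i = p1 :: behead (cut_positions 0 i).
  by rewrite cut_positionsE size_i (_ : s.-1 = s.-2.+1) //; lia.
have det_all := rows_det_unshuffle R (d := d.+1) (o := 0) (i := i) _ _ i_neq0.
have {}det_all := det_all (eqP (andP comp_i).1) (andP comp_i).2.
have all_in k : (k < d.+1)%N -> xsum (fvec R d.+1 k 0) (cuts_set d.+1 i) = - (cuts i
  k.+1)%:R.
  move=> kd; rewrite xsum_fvec; congr (- _%:R); congr nat_of_bool.
  apply/existsP/idP => [[p]|ck]; first by rewrite inE => /andP[cp /eqP <-].
  by exists (Ordinal kd); rewrite inE /= ck eqxx.
have cut_at j : (0 < j < s)%N -> [/\ (0 < partial_sum i j)%N,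
  (partial_sum i j <= d.+1)%N & cuts i (partial_sum i j)].
  move=> js; have cut_j : cuts i (partial_sum i j).
    by apply/hasP; exists j; rewrite ?mem_index_iota ?size_i //= eqxx.
  by have := cuts_range comp_i cut_j; split; rewrite //; lia.
have xsum_cut k : k \in cut_positions 0 i -> xsum (fvec R d.+1 k 0) (cuts_set d.+1 i) =
  -1.
  rewrite cut_positionsE size_i => /mapP[j]; rewrite mem_iota add0n => js ->.
  have [|P_gt0 P_le cut_j] := cut_at j.+1; first lia.
  by rewrite all_in ?prednK ?cut_j.
have xsum_block k : k \in block_positions 0 i -> xsum (fvec R d.+1 k 0) (cuts_set d.+1
  i) = 0.
  rewrite block_positionsE size_i => /flattenP[l /mapP[t]];
    rewrite mem_iota add0n => ts ->.
  rewrite mem_iota add0n => kt; pose u := Ordinal (ts : (t < s)%N).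
  have tnth_u : tnth i u = nth 0%N i t by rewrite (tnth_nth 0%N).
  have Pu := cut_posS i u; have P_last := cut_pos_last comp_i.
  have le_s := cut_pos_mono comp_i s_ge2 (a := t.+1) (b := s); rewrite /= in Pu.
  rewrite all_in; last by lia.
  rewrite (_ : cuts i k.+1 = false) ?oppr0 //; apply/hasP => -[r].
  rewrite mem_index_iota size_i => rs /= /eqP Pr.
  have /andP[r_gt0 r_s] := rs.
  have := cut_pos_uniq comp_i s_ge2 (t := Ordinal r_s) (u := u) (j := 0) (j' := (k.+1 -
    partial_sum i t)%N) (part_gt0 comp_i _).
  rewrite tnth_u addn0 /= Pr => uniq_k.
  have lt1 : (k.+1 - partial_sum i t < nth 0%N i t)%N by lia.
  have := uniq_k lt1; rewrite subnKC; last lia.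
  by rewrite eqxx => /esym/andP[_ /eqP]; lia.
have p1_in : p1 \in cut_positions 0 i by rewrite cuts_cons mem_head.
apply: (cut_facet_orientation (v0 := - fvec R d.+1 p1)) => //.
- by rewrite size_i.
- rewrite basisE size_cat !size_map size_behead size_cut_positions.
  have := size_block_positions 0 (andP comp_i).2; rewrite (eqP (andP comp_i).1) size_i;
    lia.
- move=> u; rewrite basisE mem_cat => /orP[]/mapP[k k_in ->].
    by rewrite xsumB !xsum_cut ?subrr // cuts_cons inE k_in orbT.
  exact: xsum_block.
- have -> : - fvec R d.+1 p1 = 0 - fvec R d.+1 p1 by rewrite sub0r.
  rewrite xsumB xsum_cut // opprK [xsum _ _]big1 ?add0r // => p _; exact: mxE.
- by rewrite sqrrN (sign_epsB comp_i) sqrr_sign.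
rewrite rows_detN (sign_epsB comp_i) rmorphN rmorphXn rmorphN1 mulNr -det_all;
  congr (- _).
rewrite cuts_cons /= basisE.
pose k0 := (s.-2)%N.
apply: (rows_det_add (c := fun a => if (a < k0)%N then -1 else 0)) => a a_d /=.
have size_bh : size (behead (cut_positions 0 i)) = k0.
  by rewrite size_behead size_cut_positions size_i.
rewrite map_cat !nth_cat !size_map size_bh; case: ltnP => ak.
  by rewrite !(nth_map 0%N) ?size_bh // scaleN1r.
by rewrite scale0r addr0.
Qed.

(** * Coefficients of equation (B) *)

(** The single [Mop] ends the first run of [Id], which recovers [i1]. Injectivity ensures that no
    two terms of [equationB] share a composite, so each coefficient is a single sign. *)
Lemma f_after_m_inj i1 i2 i3 j1 j2 j3 :
  f_after_m i1 i2 i3 = f_after_m j1 j2 j3 -> [/\ i1 = j1, i2 = j2 & i3 = j3].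
Proof.
case=> _; elim: i1 j1 => [|i1 IH] [|j1] //=.
  by case=> -> /(congr1 size); rewrite !size_nseq.
by case=> /IH[-> -> ->].
Qed.

Lemma m_after_f_inj : injective m_after_f.
Proof. by move=> i j [_ /inj_map]; apply=> a b []. Qed.

Lemma coeff_sign (x : composite) k c :
  coeff x ((-1 : int) ^ k *: << c >>) = (-1) ^ k * (c == x)%:R.
Proof. by rewrite coeffZ coeffU mul1r. Qed.

Lemma coeff_f_after_m n i1 i2 i3 : (i1 + i2 + i3 = n)%N -> (2 <= i2)%N ->
  coeff (f_after_m i1 i2 i3) (equationB n) = (-1) ^+ (i1 + i2 * i3).
Proof.
move=> sum_i i2_ge2; rewrite /equationB coeffB.
have lt1 : (i1 < n.+1)%N by lia.
have lt2 : (i2 < n.+1)%N by lia.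
have lt3 : (i3 < n.+1)%N by lia.
rewrite [X in _ - X](_ : _ = 0) ?subr0; last first.
  rewrite raddf_sum big1 // => s _; rewrite raddf_sum big1 // => i _ /=.
  by rewrite coeff_sign mulr0.
rewrite raddf_sum (bigD1 (Ordinal lt1)) //= [X in _ + X]big1 ?addr0; last first.
  move=> j1 j1i; rewrite raddf_sum big1 // => j2 _; rewrite raddf_sum big1 // => j3 _ /=.
  rewrite exprnP coeff_sign; case: eqP => [/f_after_m_inj[eq1 _ _]|];
    last by rewrite mulr0.
  by case/eqP: j1i; apply: val_inj.
rewrite raddf_sum (bigD1 (Ordinal lt2)) //= [X in _ + X]big1 ?addr0; last first.
  move=> j2 j2i; rewrite raddf_sum big1 // => j3 _ /=.
  rewrite exprnP coeff_sign; case: eqP => [/f_after_m_inj[_ eq2 _]|];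
    last by rewrite mulr0.
  by case/eqP: j2i; apply: val_inj.
rewrite raddf_sum (bigD1 (Ordinal lt3)) /= ?sum_i ?eqxx //= [X in _ + X]big1 ?addr0;
  last first.
  move=> j3 /andP[_ j3i].
  rewrite exprnP coeff_sign; case: eqP => [/f_after_m_inj[_ _ eq3]|];
    last by rewrite mulr0.
  by case/eqP: j3i; apply: val_inj.
by rewrite exprnP coeff_sign eqxx mulr1.
Qed.

Lemma coeff_m_after_f n (i : seq nat) : (2 <= size i)%N -> composition n i ->
  coeff (m_after_f i) (equationB n) = - (-1) ^ epsB i.
Proof.
move=> s_ge2 comp_i; rewrite /equationB coeffB.
rewrite [X in X - _](_ : _ = 0) ?sub0r; last first.
  rewrite raddf_sum big1 // => i1 _; rewrite raddf_sum big1 // => i2 _.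
  rewrite raddf_sum big1 // => i3 _ /=.
  by rewrite exprnP coeff_sign mulr0.
congr (- _); have [/eqP sum_i /allP i_gt0] := andP comp_i.
(* [equationB] ranges over at most [n] parts, each at most [n]; every composition of [n] satisfies
   both bounds. *)
have le_n a : a \in i -> (a < n.+1)%N.
  by move=> /perm_to_rem/perm_sumn; rewrite sum_i /= ltnS => ->; rewrite leq_addr.
have lt_s : (size i < n.+1)%N.
  rewrite ltnS -sum_i; elim: (i) i_gt0 => //= a l IH l_gt0.
  have := l_gt0 a (mem_head _ _); have : (size l <= sumn l)%N.
    by apply: IH => b lb; apply: l_gt0; rewrite inE lb orbT.
  lia.
have val_i : [seq val x | x <- [seq inord a : 'I_n.+1 | a <- i]] = i.
  by rewrite -map_comp -[RHS]map_id; apply/eq_in_map => a /le_n an /=; rewrite inordK.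
have sz : size [seq inord a : 'I_n.+1 | a <- i] == size i by rewrite size_map.
rewrite raddf_sum (bigD1 (Ordinal lt_s)) //= [X in _ + X]big1 ?addr0; last first.
  move=> s /andP[_ si]; rewrite raddf_sum big1 // => j _ /=.
  rewrite coeff_sign; case: eqP => [/m_after_f_inj eq_i|]; last by rewrite mulr0.
  by case/eqP: si; apply: val_inj; rewrite /= -eq_i size_map size_tuple.
rewrite raddf_sum (bigD1 (Tuple sz)) /= ?val_i //= [X in _ + X]big1 ?addr0; last first.
  move=> j /andP[_ ji].
  rewrite coeff_sign; case: eqP => [/m_after_f_inj eq_i|]; last by rewrite mulr0.
  by case/eqP: ji; apply: val_inj; apply: (inj_map val_inj); rewrite /= val_i.
by rewrite coeff_sign eqxx mulr1.
Qed.

Unset Implicit Arguments.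
Local Open Scope classical_set_scope.
Local Open Scope ring_scope.

Theorem proposition5 (R : realType) (n : nat) (n_ge2 : (2 <= n)%N) :
  let w := unit_weight R n in
  let Jn := forcey_loday w in
  let f := forcey_loday_basis R n.-1 in
  [/\ tangent_basis Jn f,
      frontier Jn =
        [set x | (exists i1 i2 i3 : nat,
                    [/\ (i1 + i2 + i3 = n)%N, (2 <= i2)%N &
                        seg_facet w i1 i2 x]) \/
                 (exists s (i : s.-tuple nat),
                    [/\ (2 <= s)%N, composition n i & cut_facet w i x])],
      (forall i1 i2 i3 : nat, (i1 + i2 + i3 = n)%N -> (2 <= i2)%N ->
         let eps : int := (-1) ^+ (i1 + i2 * i3) in
         [/\ set_bij (seg_product w i1 i2 i3) (seg_facet w i1 i2)
                     (seg_theta n i1 i2 i3),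
             boundary_orientation Jn f (seg_facet w i1 i2)
                     (seg_basis R n i1 i2 i3) eps &
             coeff (f_after_m i1 i2 i3) (equationB n) = eps]) &
      (forall s (i : s.-tuple nat), (2 <= s)%N -> composition n i ->
         let eps : int := - (-1) ^ epsB i in
         [/\ set_bij (cut_product w i) (cut_facet w i) (cut_theta n i),
             boundary_orientation Jn f (cut_facet w i) (cut_basis R n i) eps &
             coeff (m_after_f i) (equationB n) = eps])].
Proof.
case: n n_ge2 => [|[|d]] // _ w Jn f; split.
- exact: forcey_loday_tangent.
- exact: forcey_loday_frontier.
- move=> i1 i2 i3 sum_i i2_ge2 eps; split.
  + exact: seg_theta_bij.
  + exact: seg_basis_orientation.
  exact: coeff_f_after_m.
move=> s i s_ge2 comp_i eps; split.
- exact: cut_theta_bij.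
- exact: cut_basis_orientation.
by apply: coeff_m_after_f => //; rewrite size_tuple.
Qed.
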